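(* For every real number $M>0$ there exists a spherically symmetric $f_0\in\mathfrak{P}_3\cap\mathfrak{C}^1$ such that $$\mathcal{E}(f_0)=0,\qquad \mathcal{V}(f_0)<-M,\qquad \|f_0\|_{3/2}>\frac38\left(\frac{15}{16}\right)^{1/3}.$$
   Context: Points of $\mathbb{R}^6$ are written $(p,q)$ with momentum $p\in\mathbb{R}^3$ and position $q\in\mathbb{R}^3$, and $d\mu=d^3p\,d^3q$ is Lebesgue measure. $\mathfrak{P}_3\cap\mathfrak{C}^1$ denotes the set of probability measures on $\mathbb{R}^6$ whose first three moments are finite, that are absolutely continuous with respect to Lebesgue measure, and whose density is of class $C^1$; such a measure is identified with its density. So $f\ge 0$, $f\in C^1(\mathbb{R}^6)$, $\int f\,d\mu=1$, and $\int (|p|+|q|)^k f\,d\mu<\infty$ for $k=1,2,3$. Spherically symmetric means $f(Op,Oq)=f(p,q)$ for all rotations $O$ of $\mathbb{R}^3$ and all $(p,q)$. Total energy: $$\mathcal{E}(f)=\int\sqrt{1+|p|^2}\,f(p,q)\,d\mu-\frac12\iint\frac{f(p',q')f(p,q)}{|q-q'|}\,d\mu\,d\mu'.$$ Virial: $\mathcal{V}(f)=\int (q\cdot p)\,f(p,q)\,d\mu$. Norm: $\|f\|_{3/2}=\left(\int |f|^{3/2}\,d\mu\right)^{2/3}$. *)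

(* Defs.v *)
From HB Require Import structures.
From mathcomp Require Import all_boot all_order all_algebra.
From mathcomp Require Import all_classical all_reals all_analysis.

Set Implicit Arguments.
Unset Strict Implicit.
Unset Printing Implicit Defensive.

Import Order.TTheory GRing.Theory Num.Theory.
Import numFieldNormedType.Exports.

Local Open Scope classical_set_scope.
Local Open Scope ring_scope.

(* R^3 and R^6 are iterated products of R, so that the library's product
   topology, product sigma-algebra and product measure all apply to them.
   The library norm on these products is the sup norm; [enorm] below is the
   Euclidean one. *)
Definition space3 (R : realType) : Type := (R * R * R)%type.

(* z : phase R is (p, q), with momentum p = z.1 and position q = z.2. *)
Definition phase (R : realType) : Type := (space3 R * space3 R)%type.

Section Vectors.
Context {R : realType}.
Implicit Types (p q : space3 R) (O : 'M[R]_3).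

Definition dot p q : R :=
  p.1.1 * q.1.1 + p.1.2 * q.1.2 + p.2 * q.2.

Definition enorm p : R := Num.sqrt (dot p p).

(* |p - q| *)
Definition edist p q : R :=
  enorm (p.1.1 - q.1.1, p.1.2 - q.1.2, p.2 - q.2).

Definition col_of p : 'cV[R]_3 :=
  \col_(i < 3) nth 0 [:: p.1.1; p.1.2; p.2] i.

Definition of_col (c : 'cV[R]_3) : space3 R :=
  (c (inord 0) ord0, c (inord 1) ord0, c (inord 2) ord0).

Definition mxact O p : space3 R := of_col (O *m col_of p).

Definition rotation O : Prop := O^T *m O = 1%:M /\ \det O = 1.

End Vectors.

(* The canonical sigma-finite instance of the library's product measure is
   shadowed by one that applies to subprobabilities only. *)
Section ProductSigmaFinite.
Local Open Scope ereal_scope.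
Context d1 d2 (T1 : measurableType d1) (T2 : measurableType d2) (R : realType).
Variable m1 : {sigma_finite_measure set T1 -> \bar R}.
Variable m2 : {sigma_finite_measure set T2 -> \bar R}.

Lemma product_measure_sigma_finite : sigma_finite setT (m1 \x m2).
Proof.
have /sigma_finiteP[F [TF ndF Foo]] := sigma_finiteT m1.
have /sigma_finiteP[G [TG ndG Goo]] := sigma_finiteT m2.
exists (fun n => F n `*` G n).
  rewrite -setXTT TF TG predeqE => -[x y]; split.
    move=> [/= [n _ Fnx] [k _ Gky]]; exists (maxn n k) => //; split.
    - by move: x Fnx; exact/subsetPset/ndF/leq_maxl.
    - by move: y Gky; exact/subsetPset/ndG/leq_maxr.
  by move=> [n _ []/= ? ?]; split; exists n.
move=> k; have [? ?] := Foo k; have [? ?] := Goo k.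
split; first exact: measurableX.
by rewrite product_measure1E// lte_mul_pinfty// ge0_fin_numE.
Qed.
End ProductSigmaFinite.

Section Lebesgue.
Context (R : realType).
Local Notation leb := (@lebesgue_measure R).
Local Open Scope ereal_scope.

Definition leb2 := leb \x leb.
HB.instance Definition _ := Measure.on leb2.
HB.instance Definition _ := Measure_isSigmaFinite.Build _ _ _ leb2
  (product_measure_sigma_finite leb leb).

Definition leb3 := leb2 \x leb.
HB.instance Definition _ := Measure.on leb3.
HB.instance Definition _ := Measure_isSigmaFinite.Build _ _ _ leb3
  (product_measure_sigma_finite leb2 leb).

Definition leb6 := leb3 \x leb3.
HB.instance Definition _ := Measure.on leb6.
HB.instance Definition _ := Measure_isSigmaFinite.Build _ _ _ leb6
  (product_measure_sigma_finite leb3 leb3).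

End Lebesgue.

Arguments leb2 : clear implicits.
Arguments leb3 : clear implicits.
Arguments leb6 : clear implicits.

Section Functionals.
Context {R : realType}.
Implicit Types f : phase R -> R.

Definition spherically_symmetric f : Prop :=
  forall (O : 'M[R]_3), rotation O ->
  forall p q : space3 R, f (mxact O p, mxact O q) = f (p, q).

(* In finite dimension, continuity of the differential amounts to continuity
   of x |-> 'd f x v for each fixed direction v. *)
Definition is_C1 f : Prop :=
  (forall x : (R * R * R) * (R * R * R), differentiable f x) /\
  (forall v : (R * R * R) * (R * R * R), continuous ('D_v f)).

(* The C^1 densities of probability measures on R^6 with finite first three
   moments.  Such an f is continuous, hence Borel measurable. *)
Definition P3C1 f : Prop :=
  [/\ forall z, 0 <= f z,
      is_C1 f,
      (\int[leb6 R]_z (f z)%:E)%E = 1%E &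
      forall k : nat, (1 <= k <= 3)%N ->
        (\int[leb6 R]_z ((enorm z.1 + enorm z.2) ^+ k * f z)%:E < +oo)%E].

Definition kinetic f : \bar R :=
  (\int[leb6 R]_z (Num.sqrt (1 + enorm z.1 ^+ 2) * f z)%:E)%E.

(* The value 0^-1 = 0 of the kernel at coinciding positions is irrelevant: it
   is only used on a null set. *)
Definition interaction f : \bar R :=
  (\int[leb6 R]_z' \int[leb6 R]_z (f z' * f z / edist z.2 z'.2)%:E)%E.

(* Extended-real valued because the interaction integral may be +oo on P3C1,
   in which case the energy is -oo; the kinetic part is finite there. *)
Definition energy f : \bar R :=
  (kinetic f - (2^-1)%:E * interaction f)%E.

(* The integrand is integrable for f in P3C1 (second moments). *)
Definition virial f : R := \int[leb6 R]_z (dot z.2 z.1 * f z).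

(* Real-valued: [fine] sends +oo to 0, so a strict lower bound by a nonnegative
   number entails that f is in L^(3/2). *)
Definition norm32 f : R := fine (Lnorm (leb6 R) (3 / 2)%:E (EFin \o f)).

End Functionals.

(* Main.v *)
Require Import Defs.
From HB Require Import structures.
From mathcomp Require Import all_boot all_order all_algebra.
From mathcomp Require Import all_classical all_reals all_analysis.
From mathcomp Require Import measurable_realfun lra ring.
Import Order.TTheory GRing.Theory Num.Theory.
Import numFieldNormedType.Exports.
Local Open Scope classical_set_scope.
Local Open Scope ring_scope.

(** If the positions of a density f are dilated by a factor b, the kinetic
    energy does not change, the interaction I becomes I / b and the virial V
    becomes b V. The choice b = I / (2 K), with K the kinetic energy of f, thus
    gives zero total energy and virial I V / (2 K). It remains to find f with
    momenta and positions in the unit ball, so that 1 <= K <= 2, with virial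
    bounded away from 0 and I large. Take f proportional to the sum of
    - a core, the product of a bump of radius d in p and a bump of radius s in
      q, which makes I at least of order 1 / s when s is small;
    - a fixed beam, supported where p.q < 0, which gives the negative virial.
    Finally the mass of the core is spread over a set of measure of order
    (d s b)^3, so the L^(3/2) norm is large, by Hoelder's inequality, if d is
    small compared with 1 / (s b); this is possible since b <= I / 2 and I is
    bounded independently of d. *)

Set Implicit Arguments.
Unset Strict Implicit.
Unset Printing Implicit Defensive.

(* [edist] also names a distance of the normed-space library. *)
Local Notation edist := Defs.edist.

(** * Lebesgue measure on R^3 and R^6 *)

Section Lebesgue3.
Variable R : realType.
Local Notation T1 := (measurableTypeR R).
Local Notation T2 := (T1 * T1)%type.
Local Notation T3 := (T2 * T1)%type.
Local Notation leb := (@lebesgue_measure R).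
Local Open Scope ereal_scope.

Definition scale3 (b : R) (q : space3 R) : space3 R :=
  (b * q.1.1, b * q.1.2, b * q.2)%R.

(** The pushforward of Lebesgue measure under multiplication by [b], rescaled by [b], gives each
    interval []x, y]] its length, so it is Lebesgue measure by uniqueness. *)
Lemma lebesgue_measure_preimage_mul (b : R) (A : set T1) : (0 < b)%R ->
  measurable A -> leb (( *%R b : T1 -> T1) @^-1` A) = (b^-1)%:E * leb A.
Proof.
move=> b0 mA.
have mb : measurable_fun [set: T1] ( *%R b : T1 -> T1) by exact: measurable_funM.
pose P : {measure set T1 -> \bar R} :=
  measure_function_pushforward__canonical__measure_function_Measure leb mb.
have bnn : (0 <= b)%R := ltW b0.
pose mu : {measure set T1 -> \bar R} := mscale (NngNum bnn) P.
have -> : leb A = mu A; last first.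
  by rewrite /mu/= /mscale/= /pushforward muleA -EFinM mulVf ?gt_eqF// mul1e.
apply: lebesgue_measure_unique => // _ [[x y]] _ <-.
rewrite /mu/= /mscale/= /pushforward.
rewrite [X in _ * leb X](_ : _ = `]x / b, y / b]%classic)%R; last first.
  apply/seteqP; split => z; rewrite /= !in_itv/=.
    by rewrite ltr_pdivrMr// ler_pdivlMr// ![(z * _)%R]mulrC.
  by rewrite ltr_pdivrMr// ler_pdivlMr// ![(z * _)%R]mulrC.
rewrite !lebesgue_measure_itv/= !lte_fin ltr_pM2r ?invr_gt0//.
case: ifPn => _; last by rewrite mule0.
by rewrite -!EFinD -EFinM mulrBr ![(b * (_ / b))%R]mulrC !divfK ?gt_eqF.
Qed.

Lemma ge0_integral_leb_scale (b : R) (f : T1 -> \bar R) : (0 < b)%R ->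
  measurable_fun setT f -> (forall x, 0 <= f x) ->
  \int[leb]_x f (b * x)%R = (b^-1)%:E * \int[leb]_x f x.
Proof.
move=> b0 mf f0.
have mb : measurable_fun [set: T1] ( *%R b : T1 -> T1) by exact: measurable_funM.
have bnn : (0 <= b^-1)%R by rewrite invr_ge0 ltW.
rewrite -[(b^-1)%:E]/((NngNum bnn)%:num%:E) -ge0_integral_mscale//.
rewrite -[LHS]/(\int[leb]_(x in ( *%R b : T1 -> T1) @^-1` setT)
  (f \o ( *%R b : T1 -> T1)) x).
rewrite -ge0_integral_pushforward//.
by apply: eq_measure_integral => A mA _; exact: lebesgue_measure_preimage_mul.
Qed.

(** Tonelli's theorem reduces the change of variables to one coordinate at a time, each of which
    contributes a factor [b^-1]. *)
Lemma ge0_integral_leb2_scale (b : R) (f : T2 -> \bar R) : (0 < b)%R ->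
  measurable_fun setT f -> (forall x, 0 <= f x) ->
  \int[leb2 R]_x f (b * x.1, b * x.2)%R = (b ^- 2)%:E * \int[leb2 R]_x f x.
Proof.
move=> b0 mf f0.
have bnn : (0 <= b^-1)%R by rewrite invr_ge0 ltW.
have mb : measurable_fun [set: T1] ( *%R b : T1 -> T1) by exact: measurable_funM.
have mF : measurable_fun setT (fun x : T1 => \int[leb]_y f (x, y)).
  exact: measurable_fun_fubini_tonelli_F.
rewrite fubini_tonelli1//=; last first.
  apply: measurableT_comp => //.
  by apply: measurable_fun_pair; apply: measurable_funM.
rewrite /fubini_F/=.
under eq_integral => x _.
  rewrite (ge0_integral_leb_scale (f := fun y => f (b * x, y)%R))//;
    last exact: (measurableT_comp mf).
  over.
rewrite /= ge0_integralZl//; last 2 first.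
- exact: (measurableT_comp mF mb).
- by move=> x _; exact: integral_ge0.
rewrite (ge0_integral_leb_scale (f := fun x => \int[leb]_y f (x, y)))//;
  last by move=> x; exact: integral_ge0.
by rewrite muleA -EFinM -invfM -expr2 [in RHS]fubini_tonelli1.
Qed.

Lemma ge0_integral_leb3_scale (b : R) (f : space3 R -> \bar R) : (0 < b)%R ->
  measurable_fun [set: T3] f -> (forall x, 0 <= f x) ->
  \int[leb3 R]_x f (scale3 b x) = (b ^- 3)%:E * \int[leb3 R]_x f x.
Proof.
move=> b0 mf f0.
have mb : measurable_fun [set: T1] ( *%R b : T1 -> T1) by exact: measurable_funM.
have mb2 : measurable_fun [set: T2] ((fun x => (b * x.1, b * x.2)%R) : T2 -> T2).
  by apply: measurable_fun_pair; apply: measurable_funM.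
have bnn : (0 <= b^-1)%R by rewrite invr_ge0 ltW.
have mF : measurable_fun setT (fun x : T2 => \int[leb]_y f (x, y)).
  exact: measurable_fun_fubini_tonelli_F.
rewrite fubini_tonelli1//=; last first.
  apply: measurableT_comp => //.
  apply: measurable_fun_pair; [apply: measurable_fun_pair|];
    apply: measurable_funM => //; exact: measurableT_comp.
rewrite /fubini_F/=.
under eq_integral => x _.
  rewrite (ge0_integral_leb_scale (f := fun y => f (b * x.1, b * x.2, y)%R))//;
    last exact: (measurableT_comp mf).
  over.
rewrite /= ge0_integralZl//; last 2 first.
- exact: (measurableT_comp mF mb2).
- by move=> x _; exact: integral_ge0.
rewrite (ge0_integral_leb2_scale (f := fun x => \int[leb]_y f (x, y)))//;
  last by move=> x; exact: integral_ge0.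
by rewrite muleA -EFinM -invfM -exprS [in RHS]fubini_tonelli1.
Qed.

End Lebesgue3.

Section Lebesgue6.
Variable R : realType.
Local Notation T1 := (measurableTypeR R).
Local Notation T2 := (T1 * T1)%type.
Local Notation T3 := (T2 * T1)%type.
Local Notation T6 := (T3 * T3)%type.
Local Notation leb := (@lebesgue_measure R).
Local Open Scope ereal_scope.

Definition scale_pos (b : R) (z : phase R) : phase R := (z.1, scale3 b z.2).

Lemma measurable_scale3 b : measurable_fun setT (scale3 b : T3 -> T3).
Proof.
apply: measurable_fun_pair; [apply: measurable_fun_pair|];
  apply: measurable_funM => //; exact: measurableT_comp.
Qed.

Lemma measurable_scale_pos b : measurable_fun setT (scale_pos b : T6 -> T6).
Proof.
apply: measurable_fun_pair => //.
by apply: measurableT_comp => //; exact: measurable_scale3.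
Qed.

Lemma ge0_integral_leb6 (f : phase R -> \bar R) :
  measurable_fun [set: T6] f -> (forall z, 0 <= f z) ->
  \int[leb6 R]_z f z = \int[leb3 R]_p \int[leb3 R]_q f (p, q).
Proof. by move=> mf f0; rewrite [LHS]fubini_tonelli1. Qed.

Lemma ge0_integral_leb6_scale (b : R) (f : phase R -> \bar R) : (0 < b)%R ->
  measurable_fun [set: T6] f -> (forall x, 0 <= f x) ->
  \int[leb6 R]_z f (scale_pos b z) = (b ^- 3)%:E * \int[leb6 R]_z f z.
Proof.
move=> b0 mf f0.
rewrite [LHS]ge0_integral_leb6//; last first.
  exact: (measurableT_comp mf (measurable_scale_pos b)).
under eq_integral => p _.
  rewrite (ge0_integral_leb3_scale (f := fun q => f (p, q)))//.
    over.
  exact: measurableT_comp.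
rewrite /= ge0_integralZl//.
- by rewrite [in RHS]ge0_integral_leb6.
- exact: (measurable_fun_fubini_tonelli_F (m2 := leb3 R)).
- by move=> x _; exact: integral_ge0.
- by rewrite lee_fin invr_ge0 exprn_ge0// ltW.
Qed.

Lemma ge0_integral_leb6_prod (g h : space3 R -> R) :
  measurable_fun [set: T3] g -> measurable_fun [set: T3] h ->
  (forall p, 0 <= g p)%R -> (forall q, 0 <= h q)%R ->
  \int[leb6 R]_z (g z.1 * h z.2)%:E =
  \int[leb3 R]_p (g p)%:E * \int[leb3 R]_q (h q)%:E.
Proof.
move=> mg mh g0 h0.
have mg' : measurable_fun [set: T3] (EFin \o g) by exact/measurable_EFinP.
have mh' : measurable_fun [set: T3] (EFin \o h) by exact/measurable_EFinP.
rewrite ge0_integral_leb6; last 2 first.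
- apply/measurable_EFinP; apply: measurable_funM.
    exact: (measurableT_comp mg).
  exact: (measurableT_comp mh).
- by move=> z; rewrite lee_fin mulr_ge0.
transitivity (\int[leb3 R]_p ((g p)%:E * \int[leb3 R]_q (h q)%:E)).
  by apply: eq_integral => p _;
    rewrite -(ge0_integralZl _ measurableT mh') ?lee_fin// => q _; rewrite lee_fin.
rewrite (ge0_integralZr _ measurableT mg')//; first by move=> p _; rewrite lee_fin.
by apply: integral_ge0 => q _; rewrite lee_fin.
Qed.

(** Balls of the sup norm stand in for Euclidean balls: being products of intervals they have an
    explicit volume, and the constants lost are harmless. *)
Definition cube (c : space3 R) (r : R) : set (space3 R) :=
  (`]c.1.1 - r, c.1.1 + r[ `*` `]c.1.2 - r, c.1.2 + r[ `*` `]c.2 - r, c.2 + r[)%R.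

Lemma measurable_cube c r : measurable (cube c r : set T3).
Proof. by apply: measurableX => //; exact: measurableX. Qed.

Lemma leb3_cube c r : (0 <= r)%R -> leb3 R (cube c r) = ((2 * r) ^+ 3)%:E.
Proof.
move=> r0.
have itvE (x : R) : leb `](x - r)%R, (x + r)%R[%classic = (2 * r)%:E.
  rewrite lebesgue_measure_itv/= lte_fin; case: ltP => [_|xr].
    by rewrite -EFinB; congr EFin; ring.
  (* Here the interval is empty; with [0 <= r] this forces [r = 0]. *)
  by congr EFin; lra.
rewrite /leb3 /cube [LHS]product_measure1E//; last exact: measurableX.
rewrite /leb2 [X in X * _]product_measure1E//.
by rewrite [X in X * _ * _]itvE [X in _ * X * _]itvE [X in _ * X]itvE -!EFinM;
  congr EFin; ring.
Qed.

Lemma leb6_cubes c r c' r' : (0 <= r)%R -> (0 <= r')%R ->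
  leb6 R (cube c r `*` cube c' r') = ((2 * r) ^+ 3 * (2 * r') ^+ 3)%:E.
Proof.
move=> r0 r'0; rewrite /leb6 [LHS]product_measure1E//; try exact: measurable_cube.
by rewrite [X in X * _]leb3_cube// [X in _ * X]leb3_cube.
Qed.

Lemma plane_setX (x : R) : [set z : phase R | z.2.1.1 = x] =
  setT `*` ([set x] `*` setT `*` setT).
Proof.
by apply/seteqP; split => [[[[? ?] ?] [[? ?] ?]]|[[[? ?] ?] [[? ?] ?]]] /=; tauto.
Qed.

Lemma measurable_plane (x : R) : measurable ([set z | z.2.1.1 = x] : set T6).
Proof.
rewrite plane_setX; apply: measurableX => //.
by apply: measurableX => //; exact: measurableX.
Qed.

(** Serves to discard coinciding positions: phase points whose position equals a given one lie in
    such a hyperplane. *)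
Lemma leb6_plane (x : R) : leb6 R [set z | z.2.1.1 = x] = 0.
Proof.
rewrite plane_setX /leb6 [LHS]product_measure1E//; last first.
  by apply: measurableX => //; exact: measurableX.
rewrite [X in _ * X]product_measure1E//; last exact: measurableX.
rewrite [X in _ * (X * _)]product_measure1E//.
by rewrite [X in _ * (X * _ * _)]lebesgue_measure_set1 mul0e mul0e mule0.
Qed.

End Lebesgue6.

(** * The Newtonian potential of a bounded density *)

Section EuclideanGeometry.
Variable R : realType.
Local Notation T1 := (measurableTypeR R).
Local Notation T3 := (T1 * T1 * T1)%type.
Implicit Types p q : space3 R.

Lemma dot_ge0 q : 0 <= dot q q.
Proof. by rewrite /dot -!expr2 !addr_ge0// sqr_ge0. Qed.

Lemma enorm_ge0 q : 0 <= enorm q. Proof. exact: sqrtr_ge0. Qed.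

Lemma enorm_sqr q : enorm q ^+ 2 = dot q q.
Proof. by rewrite sqr_sqrtr// dot_ge0. Qed.

Lemma enorm_lt q r : 0 <= r -> (enorm q < r) = (dot q q < r ^+ 2).
Proof. by move=> r0; rewrite -enorm_sqr ltr_pXn2r// nnegrE// enorm_ge0. Qed.

Lemma enorm_le q r : 0 <= r -> (enorm q <= r) = (dot q q <= r ^+ 2).
Proof. by move=> r0; rewrite -enorm_sqr ler_pXn2r// nnegrE// enorm_ge0. Qed.

(** Lagrange's identity: the difference of the two sides is the squared norm of the cross
    product. *)
Lemma dot_cauchy p q : dot p q ^+ 2 <= dot p p * dot q q.
Proof.
rewrite -subr_ge0 /dot.
set a := p.1.1; set b := p.1.2; set c := p.2.
set x := q.1.1; set y := q.1.2; set z := q.2.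
rewrite [leRHS](_ : _ = (a * y - b * x) ^+ 2 + (a * z - c * x) ^+ 2
  + (b * z - c * y) ^+ 2); last by ring.
by rewrite !addr_ge0// sqr_ge0.
Qed.

Lemma normr_dot p q : `|dot p q| <= enorm p * enorm q.
Proof.
rewrite -(@ler_pXn2r _ 2)// ?nnegrE ?mulr_ge0 ?enorm_ge0//.
by rewrite exprMn !enorm_sqr real_normK ?num_real// dot_cauchy.
Qed.

Lemma edist_le q q' : edist q q' <= enorm q + enorm q'.
Proof.
rewrite /edist enorm_le ?addr_ge0 ?enorm_ge0//.
rewrite [leLHS](_ : _ = dot q q + dot q' q' - 2 * dot q q'); last first.
  by rewrite /dot /=; ring.
rewrite sqrrD !enorm_sqr.
have := normr_dot q q'; rewrite ler_norml => /andP[+ _]; lra.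
Qed.

Lemma edist_gt0 q q' : q.1.1 != q'.1.1 -> 0 < edist q q'.
Proof.
move=> qq'; rewrite sqrtr_gt0 /dot/= -!expr2.
by rewrite -addrA ltr_wpDr ?addr_ge0 ?sqr_ge0// exprn_even_gt0//= subr_eq0.
Qed.

Lemma edist_cube q q' r : 0 <= r -> edist q q' < r -> cube q' r q.
Proof.
move=> r0; rewrite /edist enorm_lt// /dot/= => h.
have aux (x y : R) : (x - y) ^+ 2 < r ^+ 2 -> x \in `](y - r), (y + r)[.
  move=> xy; suff : `|x - y| < r by rewrite ltr_norml in_itv/=; lra.
  by rewrite -(@ltr_pXn2r _ 2)// ?nnegrE// real_normK// num_real.
have h1 := sqr_ge0 (q.1.1 - q'.1.1).
have h2 := sqr_ge0 (q.1.2 - q'.1.2).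
have h3 := sqr_ge0 (q.2 - q'.2).
by split; [split|]; apply: aux; lra.
Qed.

Lemma edist_scale3 b q q' : 0 <= b ->
  edist (scale3 b q) (scale3 b q') = b * edist q q'.
Proof.
move=> b0; rewrite /edist /enorm -[b in RHS](ger0_norm b0) -sqrtr_sqr -sqrtrM ?sqr_ge0//.
by congr Num.sqrt; rewrite /dot/=; ring.
Qed.

Lemma enorm_scale3 b q : 0 <= b -> enorm (scale3 b q) = b * enorm q.
Proof.
move=> b0; rewrite /enorm -[b in RHS](ger0_norm b0) -sqrtr_sqr -sqrtrM ?sqr_ge0//.
by congr Num.sqrt; rewrite /dot/=; ring.
Qed.

End EuclideanGeometry.

Section Measurability.
Context d (T : measurableType d) (R : realType).
Local Notation T1 := (measurableTypeR R).
Local Notation T3 := (T1 * T1 * T1)%type.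

(** On nonnegative reals the inverse is the real power with exponent -1, also at 0, where both take
    the default value 0. *)
Lemma measurable_funV (f : T -> R) : (forall x, 0 <= f x) ->
  measurable_fun setT f -> measurable_fun setT (fun x => (f x)^-1).
Proof.
move=> f0 mf; under eq_fun do rewrite -powR_inv1//.
exact: (measurableT_comp (@measurable_powR R (-1)) mf).
Qed.

Lemma measurable_fun_sqrt (f : T -> R) :
  measurable_fun setT f -> measurable_fun setT (fun x => Num.sqrt (f x)).
Proof.
move=> mf; apply: (measurableT_comp _ mf).
by apply: continuous_measurable_fun; exact: sqrt_continuous.
Qed.

Lemma measurable_fun_dot (p q : T -> T3) : measurable_fun setT p ->
  measurable_fun setT q -> measurable_fun setT (fun x => dot (p x) (q x)).
Proof.
move=> mp mq; rewrite /dot.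
have mp1 := measurableT_comp measurable_fst mp.
have mq1 := measurableT_comp measurable_fst mq.
by apply: measurable_funD; [apply: measurable_funD|]; apply: measurable_funM;
  exact: measurableT_comp.
Qed.

Lemma measurable_fun_enorm (p : T -> T3) : measurable_fun setT p ->
  measurable_fun setT (fun x => enorm (p x)).
Proof. by move=> mp; apply: measurable_fun_sqrt; exact: measurable_fun_dot. Qed.

Lemma measurable_fun_edist (p q : T -> T3) : measurable_fun setT p ->
  measurable_fun setT q -> measurable_fun setT (fun x => edist (p x) (q x)).
Proof.
move=> mp mq; apply: measurable_fun_enorm.
have mp1 := measurableT_comp measurable_fst mp.
have mq1 := measurableT_comp measurable_fst mq.
by apply: measurable_fun_pair; [apply: measurable_fun_pair|];
  apply: measurable_funB; exact: measurableT_comp.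
Qed.

End Measurability.

Section Potential.
Variable R : realType.
Local Notation T1 := (measurableTypeR R).
Local Notation T3 := (T1 * T1 * T1)%type.

(** The least exponent [m] with [2 ^- m <= r] is positive because [r < 1]; its predecessor is the
    witness. *)
Lemma dyadic_bracket (r : R) : 0 < r -> r < 1 ->
  exists n, 2 ^- n.+1 <= r < 2 ^- n.
Proof.
move=> r0 r1.
have ex : exists n, 2 ^- n <= r.
  have := cvg_expr (z := 2^-1 : R).
  rewrite ger0_norm// invf_lt1 ?ltr1n// => /(_ isT)/cvgrPdist_lt/(_ _ r0)
    [n _ /(_ n (leqnn n))].
  rewrite sub0r normrN ger0_norm ?exprn_ge0 ?invr_ge0// exprVn => /ltW h.
  by exists n.
case: (ex_minnP ex) => -[|n] h mn.
  by move: h; rewrite expr0 invr1 leNgt r1.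
exists n; rewrite h/= ltNge; apply/negP => /mn.
by rewrite ltnn.
Qed.

Local Open Scope ereal_scope.

(* 1 / r is at most 1 + sum_n 2^(n+1) [r < 2^-n], and the ball of radius 2^-n
   lies in a cube of volume 8^(1-n); hence the constant is 1 + sum_n 16/4^n,
   bounded here with 4^-n <= 2^-n. *)
Lemma potential_bounded (h : space3 R -> R) (C : R) (q' : space3 R) :
  measurable_fun [set: T3] h -> (forall q, 0 <= h q <= C)%R ->
  \int[leb3 R]_q (h q / edist q q')%:E <=
  \int[leb3 R]_q (h q)%:E + (32 * C)%:E.
Proof.
move=> mh h0C.
have C0 : (0 <= C)%R by case/andP: (h0C q') => /le_trans; apply.
have h0 q : (0 <= h q)%R by case/andP: (h0C q).
have i20 n : (0 <= 2 ^- n :> R)%R by rewrite invr_ge0 exprn_ge0.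
pose K n (q : T3) : \bar R :=
  (C * 2 ^+ n.+1 * \1_(cube q' (2 ^- n)) q)%:E.
have K0 n q : 0 <= K n q by rewrite lee_fin !mulr_ge0// exprn_ge0.
have mK n : measurable_fun setT (K n).
  apply/measurable_EFinP; apply: measurable_funM => //.
  by apply: measurable_indic; exact: measurable_cube.
have mEh : measurable_fun [set: T3] (EFin \o h) by exact/measurable_EFinP.
have mS : measurable_fun setT (fun q : T3 => \sum_(n <oo) K n q).
  exact: ge0_emeasurable_sum.
have S0 q : 0 <= \sum_(n <oo) K n q by exact: nneseries_ge0.
apply: (@le_trans _ _ (\int[leb3 R]_q ((h q)%:E + \sum_(n <oo) K n q))).
  apply: ge0_le_integral => //.
  - by move=> q _; rewrite lee_fin divr_ge0// enorm_ge0.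
  - apply/measurable_EFinP; apply: measurable_funM => //.
    apply: measurable_funV; first by move=> q; exact: enorm_ge0.
    exact: measurable_fun_edist.
  - exact: emeasurable_funD.
  - move=> q _; have [r1|r1] := leP 1%R (edist q q').
      apply: (@le_trans _ _ (h q)%:E); last by rewrite leeDl.
      rewrite lee_fin ler_pdivrMr ?(lt_le_trans _ r1)//.
      by rewrite ler_peMr.
    (* At distance 0 the kernel has the default value [0^-1 = 0], so the left-hand side vanishes. *)
    have [r0|r0] := leP (edist q q') 0%R.
      rewrite (_ : edist q q' = 0%R) ?invr0 ?mulr0; last first.
        by apply/eqP; rewrite eq_le r0 enorm_ge0.
      by rewrite adde_ge0// lee_fin.
    have [n /andP[nr rn]] := dyadic_bracket r0 r1.
    apply: (@le_trans _ _ (K n q)).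
      rewrite /K indicE mem_set ?mulr1; last exact: edist_cube.
      rewrite lee_fin ler_pM//; first by rewrite invr_ge0 ltW.
        by case/andP: (h0C q).
      by rewrite -[leRHS]invrK lef_pV2// posrE ?invr_gt0 ?exprn_gt0.
    apply: (@le_trans _ _ (\sum_(n <oo) K n q)); last by rewrite leeDr// lee_fin.
    apply: (@le_trans _ _ (\sum_(0 <= i < n.+1) K i q)).
      by rewrite big_nat_recr//= leeDr// sume_ge0.
    exact: nneseries_lim_ge.
rewrite ge0_integralD//; last by move=> q _; rewrite lee_fin.
rewrite leeD2l// integral_nneseries//.
(* The terms [32 C / 2^(n+1)] sum to [32 C], and they dominate the integrals of [K n], which equal
   [16 C / 4^n]. *)
apply: (le_trans _ (@epsilon_trick0 R (32 * C) xpredT _)); last by rewrite mulr_ge0.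
apply: lee_nneseries => [n _ _|n _]; first exact: integral_ge0.
rewrite /K; under eq_integral do rewrite EFinM.
have mI : measurable_fun setT (fun q : T3 => (\1_(cube q' (2 ^- n)) q)%:E : \bar R).
  by apply/measurable_EFinP; apply: measurable_indic; exact: measurable_cube.
rewrite (ge0_integralZl _ measurableT mI) ?lee_fin ?mulr_ge0 ?exprn_ge0//.
rewrite integral_indic//; last exact: measurable_cube.
rewrite setIT [X in _ * X]leb3_cube// -EFinM lee_fin natrX.
set t := (2 ^+ n)%R.
have t1 : (1 <= t)%R by rewrite exprn_ege1// ler1n.
have t0 : (0 < t)%R by rewrite exprn_gt0.
rewrite exprS -/t -(@ler_pM2r _ (t ^+ 2))%R ?exprn_gt0//.
rewrite [leLHS](_ : _ = 16 * C)%R; last by field; rewrite gt_eqF.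
rewrite [leRHS](_ : _ = 16 * C * t)%R; last by field; rewrite gt_eqF.
by rewrite ler_peMr// mulr_ge0.
Qed.

End Potential.

(** * Continuously differentiable functions *)

Section ContinuouslyDifferentiable.
Variables (R : realType) (V : normedModType R).
Implicit Types f g : V -> R.

(** The condition [is_C1] over an arbitrary normed module; on phase space the two agree by
    unfolding. *)
Definition cont_diff f : Prop :=
  (forall x, differentiable f x) /\ (forall v, continuous ('D_v f)).

Lemma cont_diff_continuous f : cont_diff f -> continuous f.
Proof. by case=> df _ x; exact: differentiable_continuous. Qed.

Lemma cont_diff_linear (f : {linear V -> R}) : continuous f -> cont_diff f.
Proof.
move=> cf; split=> [x|v]; first exact/linear_differentiable/cf.
rewrite (_ : 'D_v f = cst (f v)); first exact: cst_continuous.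
apply/funext => x; rewrite deriveE; last exact/linear_differentiable/cf.
by rewrite diff_lin.
Qed.

Lemma cont_diff_cst (c : R) : cont_diff (fun=> c).
Proof.
split=> [x|v]; first exact: differentiable_cst.
rewrite (_ : 'D_v _ = cst 0); first exact: cst_continuous.
by apply/funext => x; exact: derive_cst.
Qed.

Lemma cont_diffD f g : cont_diff f -> cont_diff g ->
  cont_diff (fun x => f x + g x).
Proof.
move=> [df cf] [dg cg]; split=> [x|v]; first exact: differentiableD.
rewrite (_ : 'D_v _ = fun x => 'D_v f x + 'D_v g x).
  by move=> x; apply: cvgD; [exact: cf|exact: cg].
by apply/funext => x; rewrite -deriveD//; exact: diff_derivable.
Qed.

Lemma cont_diffM f g : cont_diff f -> cont_diff g ->
  cont_diff (fun x => f x * g x).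
Proof.
move=> C1f C1g; have := cont_diff_continuous C1f.
have := cont_diff_continuous C1g.
case: C1f C1g => [df cf] [dg cg] cg0 cf0; split=> [x|v].
  exact: differentiableM.
rewrite (_ : 'D_v _ = fun x => f x * 'D_v g x + g x * 'D_v f x).
  move=> x; apply: cvgD; apply: cvgM; [exact: cf0|exact: cg|exact: cg0|exact: cf].
by apply/funext => x; rewrite -[RHS]deriveM//; exact: diff_derivable.
Qed.

Lemma cont_diff_comp (h h' : R -> R) f : (forall t : R, is_derive t (1 : R) h (h' t)) ->
  continuous h' -> cont_diff f -> cont_diff (fun x => h (f x)).
Proof.
move=> dh ch' C1f; have cf0 := cont_diff_continuous C1f; case: C1f => df cf.
have dh' t : differentiable h t by apply/derivable1_diffP.
split=> [x|v].
  by apply: differentiable_comp => //; exact: dh'.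
rewrite (_ : 'D_v _ = fun x => 'D_v f x * h' (f x)).
  move=> x; apply: cvgM; first exact: cf.
  by apply: (@continuous_comp _ _ _ f h'); [exact: cf0|exact: ch'].
apply/funext => x; rewrite deriveE; last first.
  by apply: differentiable_comp => //; exact: dh'.
rewrite [LHS](_ : _ = ('d h (f x) \o 'd f x) v); last by rewrite -diff_comp.
rewrite /= diff1E// derive1E.
by rewrite (@derive_val _ _ _ _ _ _ _ (dh (f x))) deriveE.
Qed.

End ContinuouslyDifferentiable.

Section PositivePartSquare.
Variable R : realType.

(** Squaring the positive part makes it C^1 at 0, which yields C^1 cut-offs without any smooth bump
    function. *)
Definition pos_sq (t : R) : R := Num.max 0 t ^+ 2.

Lemma pos_sq_ge0 t : 0 <= pos_sq t. Proof. exact: sqr_ge0. Qed.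

Lemma pos_sq_le1 t : t <= 1 -> pos_sq t <= 1.
Proof.
by move=> t1; rewrite expr_le1// ?le_max ?lexx// ge_max ler01.
Qed.

Lemma pos_sq_eq0 t : t <= 0 -> pos_sq t = 0.
Proof. by move=> t0; rewrite /pos_sq max_l// expr0n. Qed.

Lemma pos_sq_gt0 t : 0 < t -> pos_sq t = t ^+ 2.
Proof. by move=> t0; rewrite /pos_sq max_r// ltW. Qed.

(* The remainder of the first-order expansion is at most quadratic, uniformly
   in the base point; this covers the base point 0 without a case distinction
   on one-sided limits. *)
Lemma is_derive_pos_sq t : is_derive t (1 : R) pos_sq (2 * Num.max 0 t).
Proof.
have rem u : `|pos_sq (u + t) - pos_sq t - 2 * Num.max 0 t * u| <= u ^+ 2.
  rewrite /pos_sq ler_norml.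
  have [h1|h1] := leP 0 t; have [h2|h2] := leP 0 (u + t);
    apply/andP; split; nra.
have : (fun h => h^-1 *: ((pos_sq \o shift t) (h *: (1 : R)) - pos_sq t)) @ 0^' -->
    (2 * Num.max 0 t).
  apply/cvgrPdist_lt => e e0; near=> h.
  have h0 : h != 0 by near: h; exact: nbhs_dnbhs_neq.
  have he : `|h| < e by near: h; apply: dnbhs0_lt.
  (* It suffices to bound the error of the difference quotient by [|h|]; after multiplication by
     [|h|] this is [rem] at [h]. *)
  apply: le_lt_trans he; rewrite -(@ler_pM2l _ `|h|) ?normr_gt0// -normrM.
  rewrite -expr2 real_normK ?num_real//.
  rewrite [X in `|X|](_ : _ =
      - (pos_sq (h + t) - pos_sq t - 2 * Num.max 0 t * h)) ?normrN//.
  rewrite /= /shift/= -[h *: 1]/(h * 1) -[_ *: _]/(_ * _) mulr1.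
  by field.
by move=> cv; apply: DeriveDef; [apply/cvg_ex; eexists; exact: cv|exact/cvg_lim].
Unshelve. all: by end_near. Qed.

Lemma continuous_pos_part2 : continuous (fun t : R => 2 * Num.max 0 t).
Proof.
move=> t; apply: cvgM; first exact: cvg_cst.
by apply: (@continuous_max _ _ (cst 0) id); [exact: cst_continuous|move=> ?].
Qed.

Lemma measurable_pos_sq : measurable_fun setT pos_sq.
Proof.
apply: measurable_funX.
exact: (@measurable_maxr _ _ _ _ (cst 0) id).
Qed.

Lemma cont_diff_pos_sq (V : normedModType R) (f : V -> R) :
  cont_diff f -> cont_diff (fun x => pos_sq (f x)).
Proof. by apply: cont_diff_comp is_derive_pos_sq continuous_pos_part2. Qed.

End PositivePartSquare.

(** * Dilation of the positions *)

Section Dilation.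
Variable R : realType.
Local Notation T1 := (measurableTypeR R).
Local Notation T3 := (T1 * T1 * T1)%type.
Local Notation T6 := (T3 * T3)%type.
Variables (b : R) (b_gt0 : 0 < b).
Implicit Types f : phase R -> R.

(** The factor [b ^- 3] compensates the volume change of the dilation, so that the total mass is
    preserved. *)
Definition dilate f (z : phase R) : R := b ^- 3 * f (scale_pos b^-1 z).

Lemma measurable_dilate f :
  measurable_fun [set: T6] f -> measurable_fun [set: T6] (dilate f).
Proof.
move=> mf; apply: measurable_funM => //.
exact: (measurableT_comp mf (measurable_scale_pos _)).
Qed.

Lemma dilate_ge0 f z : (forall w, 0 <= f w) -> 0 <= dilate f z.
Proof. by move=> f0; rewrite mulr_ge0// invr_ge0 exprn_ge0// ltW. Qed.

Local Open Scope ereal_scope.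

Lemma ge0_integral_dilate (f : phase R -> \bar R) :
  measurable_fun [set: T6] f -> (forall z, 0 <= f z) ->
  \int[leb6 R]_z ((b ^- 3)%:E * f (scale_pos b^-1 z)) = \int[leb6 R]_z f z.
Proof.
move=> mf f0; rewrite ge0_integralZl//; last 2 first.
- exact: (measurableT_comp mf (measurable_scale_pos _)).
- by rewrite lee_fin invr_ge0 exprn_ge0// ltW.
rewrite ge0_integral_leb6_scale ?invr_gt0// muleA -EFinM exprVn invrK.
by rewrite mulVf ?mul1e// expf_neq0// gt_eqF.
Qed.

(** Signed functions are allowed with a view to the virial. As [b ^- 3] is nonnegative, the positive
    and negative parts transform separately. *)
Lemma integral_dilate f : measurable_fun [set: T6] f ->
  \int[leb6 R]_z (dilate f z)%:E = \int[leb6 R]_z (f z)%:E.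
Proof.
move=> mf; have mEf : measurable_fun [set: T6] (EFin \o f) by exact/measurable_EFinP.
have b3 : (0 <= b ^- 3)%R by rewrite invr_ge0 exprn_ge0// ltW.
rewrite integralE [in RHS]integralE; congr (_ - _).
  rewrite -(@ge0_integral_dilate (fun z => (EFin \o f)^\+ z))//; last first.
    exact: measurable_funepos.
  apply: eq_integral => z _.
  by rewrite -[LHS]/((fun z => (b ^- 3)%:E * (f (scale_pos b^-1 z))%:E)^\+ z)
    ge0_funeposM// !funeposE.
rewrite -(@ge0_integral_dilate (fun z => (EFin \o f)^\- z))//; last first.
  exact: measurable_funeneg.
apply: eq_integral => z _.
by rewrite -[LHS]/((fun z => (b ^- 3)%:E * (f (scale_pos b^-1 z))%:E)^\- z)
    ge0_funenegM// !funenegE.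
Qed.

(** The kinetic weight depends on the momentum alone, which the dilation fixes. *)
Lemma kinetic_dilate f : measurable_fun [set: T6] f ->
  kinetic (dilate f) = kinetic f.
Proof.
move=> mf; rewrite /kinetic -[RHS]integral_dilate.
  by apply: eq_integral => z _; rewrite /dilate mulrCA.
apply: measurable_funM => //; apply: measurable_fun_sqrt.
apply: measurable_funD => //; apply: measurable_funX.
exact: measurable_fun_enorm.
Qed.

(** The weight [q.p] is homogeneous of degree 1 in the position; integrability allows the factor [b]
    to be taken out of the real-valued integral. *)
Lemma virial_dilate f : measurable_fun [set: T6] f ->
  (leb6 R).-integrable setT (fun z => (dot z.2 z.1 * f z)%:E) ->
  virial (dilate f) = (b * virial f)%R.
Proof.
move=> mf intf; rewrite /virial -RintegralZl// /Rintegral; congr fine.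
rewrite -[RHS]integral_dilate.
  apply: eq_integral => z _; rewrite /dilate; congr EFin.
  by rewrite /dot/=; field; rewrite gt_eqF.
apply: measurable_funM => //; apply: measurable_funM => //.
by apply: measurable_fun_dot.
Qed.

Lemma measurable_interaction f : measurable_fun [set: T6] f ->
  measurable_fun [set: T6 * T6]
    (fun w => (f w.1 * f w.2 / edist w.2.2 w.1.2)%:E : \bar R).
Proof.
move=> mf; apply/measurable_EFinP; apply: measurable_funM.
  by apply: measurable_funM; exact: (measurableT_comp mf).
apply: measurable_funV; first by move=> w; exact: enorm_ge0.
by apply: measurable_fun_edist; exact: measurableT_comp.
Qed.

Lemma measurable_interaction_section f z' : measurable_fun [set: T6] f ->
  measurable_fun [set: T6]
    (fun z => (f z' * f z / edist z.2 z'.2)%:E : \bar R).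
Proof.
move=> mf; apply/measurable_EFinP; apply: measurable_funM.
  exact: measurable_funM.
apply: measurable_funV; first by move=> w; exact: enorm_ge0.
by apply: measurable_fun_edist.
Qed.

Lemma measurable_potential f : measurable_fun [set: T6] f -> (forall z, 0 <= f z)%R ->
  measurable_fun [set: T6]
    (fun z' => \int[leb6 R]_z (f z' * f z / edist z.2 z'.2)%:E).
Proof.
move=> mf f0; have int0 w : 0 <= (f w.1 * f w.2 / edist w.2.2 w.1.2)%:E.
  by rewrite lee_fin divr_ge0 ?mulr_ge0// enorm_ge0.
exact: (measurable_fun_fubini_tonelli_F (m2 := leb6 R) _ (measurable_interaction mf) int0).
Qed.

(** The kernel is homogeneous of degree -1 in the positions. The change of variables is made in the
    outer integral first, then in the inner one. *)
Lemma interaction_dilate f : measurable_fun [set: T6] f -> (forall z, 0 <= f z)%R ->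
  interaction (dilate f) = (b^-1)%:E * interaction f.
Proof.
move=> mf f0; rewrite /interaction.
set Phi := fun z' => \int[leb6 R]_z (f z' * f z / edist z.2 z'.2)%:E.
have mPhi : measurable_fun [set: T6] Phi by exact: measurable_potential.
have Phi0 z : 0 <= Phi z.
  by apply: integral_ge0 => w _; rewrite lee_fin divr_ge0 ?mulr_ge0// enorm_ge0.
have bi0 : 0 <= (b^-1)%:E by rewrite lee_fin invr_ge0 ltW.
rewrite -(@ge0_integralZl _ T6 R (leb6 R) setT measurableT _ mPhi (b^-1)%:E
  (fun z _ => Phi0 z) bi0).
rewrite -[RHS]ge0_integral_dilate; last 2 first.
- exact: emeasurable_funM.
- by move=> z; rewrite mule_ge0.
apply: eq_integral => z' _; rewrite /Phi muleA -EFinM.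
rewrite -ge0_integralZl_EFin//; last 3 first.
- by move=> w _; rewrite lee_fin divr_ge0 ?mulr_ge0// enorm_ge0.
- exact: measurable_interaction_section.
- by rewrite mulr_ge0// invr_ge0 ?exprn_ge0// ltW.
rewrite -[RHS]ge0_integral_dilate; last 2 first.
- apply: emeasurable_funM => //.
  exact: measurable_interaction_section.
- move=> z; rewrite -EFinM lee_fin !mulr_ge0// invr_ge0 ?exprn_ge0 ?enorm_ge0// ltW//.
apply: eq_integral => z _; rewrite -!EFinM; congr EFin.
rewrite /dilate/= edist_scale3 ?invr_ge0 ?ltW//.
rewrite [(b^-1 * edist _ _)^-1%R]invfM invrK.
(* The inverse distance is generalised as a whole, since the distance may be 0. *)
by move: (edist z.2 z'.2)^-1%R => e; field; rewrite gt_eqF.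
Qed.

Lemma scale_posK (z : phase R) : scale_pos b^-1 (scale_pos b z) = z.
Proof.
case: z => p [[x y] w]; rewrite /scale_pos /scale3/=.
by rewrite !mulKf// gt_eqF.
Qed.

End Dilation.

(** * Lower bound of the L^(3/2) norm by Hoelder's inequality *)

Section HoelderLowerBound.
Variable R : realType.
Local Notation T1 := (measurableTypeR R).
Local Notation T3 := (T1 * T1 * T1)%type.
Local Notation T6 := (T3 * T3)%type.
Implicit Types f g : phase R -> R.
Local Open Scope ereal_scope.

(** Integrate the pointwise bound of [f] to the power 3/2 by [C] to the power 1/2 times [f].
    Finiteness is essential, since [fine] would turn an infinite norm into 0. *)
Lemma Lnorm32_fin f (C : R) : measurable_fun [set: T6] f ->
  (forall z, 0 <= f z <= C)%R -> \int[leb6 R]_z (f z)%:E < +oo ->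
  Lnorm (leb6 R) (3 / 2)%:E (EFin \o f) \is a fin_num.
Proof.
move=> mf f0C intf; rewrite ge0_fin_numE ?Lnorm_ge0// unlock.
apply: poweR_lty.
have f0 z : (0 <= f z)%R by case/andP: (f0C z).
have C0 : (0 <= C)%R by case/andP: (f0C ((0,0,0),(0,0,0))%R) => /le_trans; apply.
apply: (@le_lt_trans _ _ (\int[leb6 R]_z ((C `^ (1 / 2))%:E * (f z)%:E))).
  apply: ge0_le_integral => //.
  - by move=> z _; exact: poweR_ge0.
  - apply/measurable_EFinP => /=.
    under eq_fun do rewrite ger0_norm//.
    exact: (measurableT_comp (@measurable_powR R (3 / 2)) mf).
  - apply/measurable_EFinP => /=; exact: measurable_funM.
  - move=> z _ /=; rewrite ger0_norm// lee_fin.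
    have [->|fz0] := eqVneq (f z) 0%R.
      by rewrite powR0 ?mulr0// gt_eqF// divr_gt0.
    rewrite (_ : 3 / 2 = 1 / 2 + 1)%R; last by field.
    rewrite powRD ?fz0 ?implybT// powRr1// ler_wpM2r//.
    by rewrite ge0_ler_powR// ?nnegrE//; case/andP: (f0C z).
have mEf : measurable_fun [set: T6] (EFin \o f) by exact/measurable_EFinP.
rewrite (ge0_integralZl _ _ mEf) ?lee_fin ?powR_ge0//; last first.
  by move=> z _; rewrite lee_fin.
by rewrite lte_mul_pinfty// lee_fin powR_ge0.
Qed.

(** Here [g] is a part of [f] of mass [a] that lives on [S]. By Hoelder with exponents 3/2 and 3,
    [a] is at most the norm of [f] times the L^3 norm of the indicator of [S], and the latter is
    [V]. *)
Lemma Lnorm32_ge f g (S : set T6) (V a C : R) : measurable_fun [set: T6] f ->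
  (forall z, 0 <= f z <= C)%R -> \int[leb6 R]_z (f z)%:E < +oo ->
  measurable_fun [set: T6] g -> (forall z, 0 <= g z)%R ->
  (forall z, g z <= f z * \1_S z)%R -> \int[leb6 R]_z (g z)%:E = a%:E ->
  measurable S -> (0 < V)%R -> leb6 R S = (V ^+ 3)%:E ->
  (a / V <= norm32 f)%R.
Proof.
move=> mf f0C intf mg g0 gf ga mS V0 SV.
have f0 z : (0 <= f z)%R by case/andP: (f0C z).
have finN := Lnorm32_fin mf f0C intf.
rewrite /norm32 ler_pdivrMr// -lee_fin EFinM fineK//.
have mI : measurable_fun [set: T6] (\1_S : T6 -> R) by exact: measurable_indic.
have H := @hoelder _ _ _ (leb6 R) f (\1_S : T6 -> R) (3 / 2)%R 3%R mf mI.
have NI : Lnorm (leb6 R) 3%:E (EFin \o (\1_S : T6 -> R)) = V%:E.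
  rewrite unlock.
  rewrite (_ : \int[_]_x _ = \int[leb6 R]_z (\1_S z)%:E); last first.
    apply: eq_integral => z _ /=; rewrite indicE.
    by case: (_ \in _) => /=; rewrite ?normr1 ?normr0 ?poweR_EFin ?powR1 ?powR0// pnatr_eq0.
  rewrite integral_indic// setIT [X in X `^ _]SV poweR_EFin.
  by rewrite -powR_mulrn ?ltW// -powRrM mulfV ?powRr1 ?ltW// pnatr_eq0.
rewrite -NI; apply: le_trans (H _ _ _) => //; last by field.
rewrite Lnorm1 -ga; apply: ge0_le_integral => //.
- by move=> z _; rewrite lee_fin.
- exact/measurable_EFinP.
- by apply: measurableT_comp => //; apply/measurable_EFinP; exact: measurable_funM.
- by move=> z _ /=; rewrite lee_fin (le_trans (gf z))// ler_norm.
Qed.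

End HoelderLowerBound.

(** * The building blocks of the density *)

Section RotationInvariance.
Variable R : realType.
Implicit Types (p q : space3 R) (O : 'M[R]_3).

(** In this form invariance under rotations follows from [O^T *m O = 1%:M]. *)
Lemma dot_col_of p q : dot p q = ((col_of p)^T *m col_of q) ord0 ord0.
Proof.
rewrite mxE !big_ord_recl big_ord0 addr0 !mxE/= /dot.
by rewrite addrA.
Qed.

Lemma of_colK (c : 'cV[R]_3) : col_of (of_col c) = c.
Proof.
apply/colP => i; rewrite mxE /of_col/=.
case: i => -[|[|[|//]]] i3 /=; congr (c _ _); apply/val_inj; rewrite /= ?inordK//.
Qed.

Lemma dot_mxact O p q : rotation O -> dot (mxact O p) (mxact O q) = dot p q.
Proof.
case=> OO _; rewrite !dot_col_of !of_colK trmx_mul mulmxA -(mulmxA _ O^T) OO.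
by rewrite mulmx1.
Qed.

Lemma mxact_scale3 O b p : scale3 b (mxact O p) = mxact O (scale3 b p).
Proof.
rewrite /mxact; have -> : col_of (scale3 b p) = b *: col_of p.
  apply/colP => i; rewrite !mxE /=.
  by case: i => -[|[|[|//]]].
by rewrite /of_col -scalemxAr !mxE.
Qed.

End RotationInvariance.

Section PhaseCoordinates.
Variable R : realType.
Local Notation V3 := (R * R * R)%type.
Local Notation V := (V3 * V3)%type.

(** Coordinates are continuous and linear; the C^1 regularity of the density is built up from
    them. *)
Lemma cont_diff_coords :
  [/\ cont_diff (fun z : V => z.1.1.1), cont_diff (fun z : V => z.1.1.2),
      cont_diff (fun z : V => z.1.2), cont_diff (fun z : V => z.2.1.1) &
      cont_diff (fun z : V => z.2.1.2) /\ cont_diff (fun z : V => z.2.2)].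
Proof.
pose L (f : V -> R) (lf : linear f) : {linear V -> R} :=
  HB.pack f (GRing.isLinear.Build _ _ _ _ f lf).
have H (f : V -> R) (lf : linear f) : continuous f -> cont_diff f.
  exact: (@cont_diff_linear _ _ (L f lf)).
have c1 : continuous (fst : V -> V3) by move=> z; exact: cvg_fst.
have c2 : continuous (snd : V -> V3) by move=> z; exact: cvg_snd.
have d1 : continuous (fst : V3 -> (R * R)%type) by move=> z; exact: cvg_fst.
have d2 : continuous (snd : V3 -> R) by move=> z; exact: cvg_snd.
have e1 : continuous (fst : (R * R)%type -> R) by move=> z; exact: cvg_fst.
have e2 : continuous (snd : (R * R)%type -> R) by move=> z; exact: cvg_snd.
have co (T U W : topologicalType) (f : T -> U) (g : U -> W) :
  continuous f -> continuous g -> continuous (g \o f).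
  by move=> cf cg x; apply: (@continuous_comp T U W f g x); [exact: cf|exact: cg].
split; last split; apply: H => //.
- exact: (co _ _ _ _ _ (co _ _ _ _ _ c1 d1) e1).
- exact: (co _ _ _ _ _ (co _ _ _ _ _ c1 d1) e2).
- exact: (co _ _ _ _ _ c1 d2).
- exact: (co _ _ _ _ _ (co _ _ _ _ _ c2 d1) e1).
- exact: (co _ _ _ _ _ (co _ _ _ _ _ c2 d1) e2).
- exact: (co _ _ _ _ _ c2 d2).
Qed.

End PhaseCoordinates.

(** * Comparison of integrals of nonnegative real functions *)

Section IntegralBounds.
Context d (T : measurableType d) (R : realType) (mu : {measure set T -> \bar R}).
Local Open Scope ereal_scope.

Lemma ge0_integralZl_real (c : R) (f : T -> R) :
  measurable_fun setT f -> (forall x, 0 <= f x)%R -> (0 <= c)%R ->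
  \int[mu]_x (c * f x)%:E = c%:E * \int[mu]_x (f x)%:E.
Proof.
move=> mf f0 c0; rewrite -ge0_integralZl_EFin//.
- by move=> x _; rewrite lee_fin.
- exact/measurable_EFinP.
Qed.

Lemma ge0_le_integral_real (f g : T -> R) :
  measurable_fun setT f -> measurable_fun setT g ->
  (forall x, 0 <= f x)%R -> (forall x, f x <= g x)%R ->
  \int[mu]_x (f x)%:E <= \int[mu]_x (g x)%:E.
Proof.
move=> mf mg f0 fg; apply: ge0_le_integral => //.
- by move=> x _; rewrite lee_fin.
- exact/measurable_EFinP.
- exact/measurable_EFinP.
- by move=> x _; rewrite lee_fin.
Qed.

Lemma ge0_integrable_real (f : T -> R) : measurable_fun setT f ->
  (forall x, 0 <= f x)%R -> \int[mu]_x (f x)%:E < +oo ->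
  mu.-integrable setT (EFin \o f).
Proof.
move=> mf f0 foo; apply/integrableP; split; first exact/measurable_EFinP.
by under eq_integral do rewrite /= ger0_norm//.
Qed.

Lemma integral_ge_cst (f : T -> R) (S : set T) (c V : R) :
  measurable_fun setT f -> (forall x, 0 <= f x)%R -> measurable S ->
  mu S = V%:E -> (0 <= c)%R -> (forall x, S x -> c <= f x)%R ->
  (c * V)%:E <= \int[mu]_x (f x)%:E.
Proof.
move=> mf f0 mS muS c0 cf.
have mI : measurable_fun setT (\1_S : T -> R) by exact: measurable_indic.
have intI : \int[mu]_x (\1_S x)%:E = V%:E by rewrite integral_indic// setIT.
rewrite EFinM -intI -ge0_integralZl_real//.
apply: ge0_le_integral_real => //.
- exact: measurable_funM.
- by move=> x; rewrite mulr_ge0.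
- move=> x; rewrite indicE.
  by case: (boolP (x \in S)) => [/set_mem/cf|_]; rewrite /= ?mulr1// mulr0.
Qed.

Lemma integral_le_cst (f : T -> R) (S : set T) (c V : R) :
  measurable_fun setT f -> (forall x, 0 <= f x)%R -> measurable S ->
  mu S = V%:E -> (0 <= c)%R -> (forall x, f x <= c * \1_S x)%R ->
  \int[mu]_x (f x)%:E <= (c * V)%:E.
Proof.
move=> mf f0 mS muS c0 cf.
have mI : measurable_fun setT (\1_S : T -> R) by exact: measurable_indic.
have intI : \int[mu]_x (\1_S x)%:E = V%:E by rewrite integral_indic// setIT.
rewrite EFinM -intI -ge0_integralZl_real//.
by apply: ge0_le_integral_real => //; exact: measurable_funM.
Qed.

Lemma fin_integral (f : T -> R) (C : R) : (forall x, 0 <= f x)%R ->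
  \int[mu]_x (f x)%:E <= C%:E ->
  \int[mu]_x (f x)%:E = (fine (\int[mu]_x (f x)%:E))%:E.
Proof.
move=> f0 fC; rewrite fineK// ge0_fin_numE.
  by rewrite (le_lt_trans fC)// ltry.
by apply: integral_ge0 => x _; rewrite lee_fin.
Qed.

End IntegralBounds.

(** * Radial bumps on R^3 *)

Section Bump.
Variable R : realType.
Local Notation T1 := (measurableTypeR R).
Local Notation T3 := (T1 * T1 * T1)%type.
Local Notation o3 := ((0, 0, 0) : space3 R).
Implicit Types (p q : space3 R) (r : R).

(** The use of [dot q q] instead of the norm keeps the function C^1 at the origin. *)
Definition bump r q : R := pos_sq (1 - dot q q / r ^+ 2).

Lemma bump_ge0 r q : 0 <= bump r q. Proof. exact: pos_sq_ge0. Qed.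

Lemma bump_le1 r q : bump r q <= 1.
Proof. by rewrite pos_sq_le1// lerBlDr lerDl divr_ge0 ?dot_ge0 ?sqr_ge0. Qed.

Lemma bump_eq0 r q : 0 < r -> r <= enorm q -> bump r q = 0.
Proof.
move=> r0 rq; rewrite /bump pos_sq_eq0// subr_le0 ler_pdivlMr ?exprn_gt0// mul1r.
by rewrite -enorm_sqr ler_pXn2r// nnegrE ltW// (lt_le_trans r0).
Qed.

Lemma enorm_cube r q : 0 <= r -> enorm q < r -> cube o3 r q.
Proof.
move=> r0 qr; apply: edist_cube => //.
by rewrite /Defs.edist /enorm /dot/= !subr0.
Qed.

Lemma bump_cube r q : 0 < r -> bump r q <= \1_(cube o3 r) q.
Proof.
move=> r0; rewrite indicE; have [qr|rq] := ltP (enorm q) r.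
  by rewrite mem_set ?bump_le1//; apply: enorm_cube => //; exact: ltW.
by rewrite bump_eq0.
Qed.

Lemma measurable_bump r : measurable_fun [set: T3] (bump r).
Proof.
apply: (measurableT_comp (@measurable_pos_sq R)).
apply: measurable_funB => //; apply: measurable_funM => //.
by apply: measurable_fun_dot.
Qed.

Definition bump_mass r : R := fine (\int[leb3 R]_q (bump r q)%:E)%E.

Lemma integral_bump r : 0 < r ->
  (\int[leb3 R]_q (bump r q)%:E)%E = (bump_mass r)%:E.
Proof.
move=> r0; apply: (@fin_integral _ _ _ (leb3 R) _ (1 * (2 * r) ^+ 3) (bump_ge0 r)).
apply: (@integral_le_cst _ _ _ (leb3 R) _ (cube o3 r) 1 ((2 * r) ^+ 3)) => //.
- exact: measurable_bump.
- exact: bump_ge0.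
- exact: measurable_cube.
- by rewrite [LHS]leb3_cube// ltW.
- by move=> q; rewrite mul1r bump_cube.
Qed.

(** On the cube of half-side [r / 2] one has [|q|^2 <= 3 r^2 / 4], so the bump is at least
    [(1/4)^2 = 1/16] there. *)
Lemma bump_mass_gt0 r : 0 < r -> 0 < bump_mass r.
Proof.
move=> r0; rewrite -lte_fin -integral_bump//.
apply: (@lt_le_trans _ _ (((1 / 16) * (2 * (r / 2)) ^+ 3)%:E)).
  by rewrite lte_fin mulr_gt0 ?exprn_gt0//; lra.
apply: (@integral_ge_cst _ _ _ (leb3 R) _ (cube o3 (r / 2))).
- exact: measurable_bump.
- exact: bump_ge0.
- exact: measurable_cube.
- by rewrite [LHS]leb3_cube//; lra.
- lra.
case=> [[x y] z] [[/=]]; rewrite !in_itv/= => hx hy hz.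
have h : 1 / 4 <= 1 - dot (x, y, z) (x, y, z) / r ^+ 2.
  rewrite lerBrDr -lerBrDl ler_pdivrMr ?exprn_gt0// /dot/=; nra.
rewrite /bump pos_sq_gt0; last by apply: lt_le_trans h; lra.
by rewrite (_ : 1 / 16 = (1 / 4) ^+ 2); [rewrite ler_pXn2r// nnegrE; lra|field].
Qed.

Definition unit_bump r q : R := bump r q / bump_mass r.

Lemma unit_bump_ge0 r q : 0 < r -> 0 <= unit_bump r q.
Proof. by move=> r0; rewrite divr_ge0 ?bump_ge0// ltW// bump_mass_gt0. Qed.

Lemma unit_bump_le r q : 0 < r -> unit_bump r q <= (bump_mass r)^-1.
Proof.
move=> r0; rewrite /unit_bump -[leRHS]mul1r ler_pM2r ?invr_gt0 ?bump_mass_gt0//.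
exact: bump_le1.
Qed.

Lemma unit_bump_eq0 r q : 0 < r -> r <= enorm q -> unit_bump r q = 0.
Proof. by move=> r0 rq; rewrite /unit_bump bump_eq0// mul0r. Qed.

Lemma measurable_unit_bump r : measurable_fun [set: T3] (unit_bump r).
Proof. by apply: measurable_funM => //; exact: measurable_bump. Qed.

Lemma integral_unit_bump r : 0 < r ->
  (\int[leb3 R]_q (unit_bump r q)%:E)%E = 1%E.
Proof.
move=> r0.
rewrite (_ : (\int[_]_q _ = \int[leb3 R]_q ((bump_mass r)^-1 * bump r q)%:E)%E).
  rewrite (@ge0_integralZl_real _ _ _ (leb3 R)).
  - rewrite [X in (_ * X)%E]integral_bump// -EFinM mulVf//.
    by rewrite gt_eqF// bump_mass_gt0.
  - exact: measurable_bump.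
  - exact: bump_ge0.
  - by rewrite invr_ge0 ltW// bump_mass_gt0.
by apply: eq_integral => q _; rewrite /unit_bump mulrC.
Qed.

End Bump.

(** * The beam, the core and their normalised sum *)

Section Mixture.
Variable R : realType.
Local Notation T1 := (measurableTypeR R).
Local Notation T3 := (T1 * T1 * T1)%type.
Local Notation T6 := (T3 * T3)%type.
Local Notation o3 := ((0, 0, 0) : space3 R).
Local Notation unit_cubes := (cube o3 1 `*` cube o3 1).

(* Vanishing unless p.q < 0, so that its virial is negative. *)
Definition beam (z : phase R) : R :=
  bump 1 z.1 * bump 1 z.2 * pos_sq (- dot z.1 z.2).

Lemma beam_ge0 z : 0 <= beam z.
Proof.
by apply: mulr_ge0; [apply: mulr_ge0; exact: bump_ge0|exact: pos_sq_ge0].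
Qed.

Lemma beam_eq0 z : (1 <= enorm z.1) || (1 <= enorm z.2) -> beam z = 0.
Proof.
by case/orP => h; rewrite /beam (bump_eq0 ltr01 h) ?mulr0 ?mul0r.
Qed.

(** For [|p| < 1] and [|q| < 1] the last factor of the beam is at most 1 by Cauchy-Schwarz;
    elsewhere the beam vanishes. *)
Lemma beam_le z : beam z <= bump 1 z.1 * bump 1 z.2.
Proof.
have [h|] := boolP ((1 <= enorm z.1) || (1 <= enorm z.2)).
  by rewrite beam_eq0// mulr_ge0// bump_ge0.
rewrite negb_or -!ltNge => /andP[h1 h2].
apply: ler_piMr; first by apply: mulr_ge0; exact: bump_ge0.
apply: pos_sq_le1.
apply: (le_trans (ler_norm _)); rewrite normrN; apply: (le_trans (normr_dot _ _)).
by rewrite mulr_ile1 ?enorm_ge0// ltW.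
Qed.

Lemma beam_le_indic z : beam z <= \1_unit_cubes z.
Proof.
apply: (le_trans (beam_le z)).
have -> : \1_unit_cubes z = \1_(cube o3 1) z.1 * \1_(cube o3 1) z.2 :> R.
  by rewrite !indicE -natrM mulnb in_setX.
by rewrite ler_pM ?bump_ge0// bump_cube.
Qed.

Lemma measurable_beam : measurable_fun [set: T6] beam.
Proof.
apply: measurable_funM; first by
  apply: measurable_funM; apply: (measurableT_comp (@measurable_bump R 1)).
apply: (measurableT_comp (@measurable_pos_sq R)).
by apply: measurableT_comp => //; exact: measurable_fun_dot.
Qed.

Lemma measurable_unit_cubes : measurable (unit_cubes : set T6).
Proof. by apply: measurableX; exact: measurable_cube. Qed.

Definition beam_mass : R := fine (\int[leb6 R]_z (beam z)%:E)%E.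

Lemma integral_beam : (\int[leb6 R]_z (beam z)%:E)%E = beam_mass%:E.
Proof.
apply: (@fin_integral _ _ _ (leb6 R) _ (1 * ((2 * 1) ^+ 3 * (2 * 1) ^+ 3)) beam_ge0).
apply: (@integral_le_cst _ _ _ (leb6 R) _ unit_cubes).
- exact: measurable_beam.
- exact: beam_ge0.
- exact: measurable_unit_cubes.
- exact: leb6_cubes.
- by [].
- by move=> z; rewrite mul1r beam_le_indic.
Qed.

Lemma beam_mass_ge0 : 0 <= beam_mass.
Proof. by apply: fine_ge0; apply: integral_ge0 => z _; rewrite lee_fin beam_ge0. Qed.

(** The sign makes the integrand nonnegative: the virial of the beam is minus this number. *)
Definition beam_virial : R :=
  fine (\int[leb6 R]_z (- dot z.2 z.1 * beam z)%:E)%E.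

Lemma dotC (p q : space3 R) : dot p q = dot q p.
Proof. by rewrite /dot; ring. Qed.

Lemma beam_virial_integrand_ge0 (z : phase R) : 0 <= - dot z.2 z.1 * beam z.
Proof.
rewrite dotC; have [h|h] := leP 0 (dot z.1 z.2).
  by rewrite /beam pos_sq_eq0 ?mulr0// oppr_le0.
by rewrite mulr_ge0 ?beam_ge0// oppr_ge0 ltW.
Qed.

Lemma measurable_beam_virial :
  measurable_fun [set: T6] (fun z => - dot z.2 z.1 * beam z).
Proof.
apply: measurable_funM; last exact: measurable_beam.
by apply: measurableT_comp => //; exact: measurable_fun_dot.
Qed.

Lemma integral_beam_virial :
  (\int[leb6 R]_z (- dot z.2 z.1 * beam z)%:E)%E = beam_virial%:E.
Proof.
apply: (@fin_integral _ _ _ (leb6 R) _ (1 * ((2 * 1) ^+ 3 * (2 * 1) ^+ 3))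
  beam_virial_integrand_ge0).
apply: (@integral_le_cst _ _ _ (leb6 R) _ unit_cubes).
- exact: measurable_beam_virial.
- exact: beam_virial_integrand_ge0.
- exact: measurable_unit_cubes.
- exact: leb6_cubes.
- by [].
move=> z; rewrite mul1r; apply: le_trans (beam_le_indic z).
have [h|] := boolP ((1 <= enorm z.1) || (1 <= enorm z.2)).
  by rewrite beam_eq0// mulr0.
rewrite negb_or -!ltNge => /andP[h1 h2].
rewrite ler_piMl ?beam_ge0//.
apply: (le_trans (ler_norm _)); rewrite normrN; apply: (le_trans (normr_dot _ _)).
by rewrite mulr_ile1 ?enorm_ge0// ltW.
Qed.

Lemma beam_virial_gt0 : 0 < beam_virial.
Proof.
rewrite -lte_fin -integral_beam_virial.
pose p0 : space3 R := (1 / 2, 0, 0); pose q0 : space3 R := (- (1 / 2), 0, 0).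
(* On the cubes of half-side 1/8 about the opposite points [p0] and [q0], [|p|^2] and [|q|^2] are at
   most 27/64, so each bump is at least [(1/2)^2], and [- p.q] is at least 7/64, hence at least
   1/16. The last two factors are the volumes of the cubes. *)
apply: (@lt_le_trans _ _ (((1 / 16) * (1 / 4 * (1 / 4) * (1 / 16) ^+ 2) *
   ((2 * (1 / 8)) ^+ 3 * (2 * (1 / 8)) ^+ 3))%:E)).
  by rewrite lte_fin; rewrite !mulr_gt0 ?exprn_gt0//; lra.
apply: (@integral_ge_cst _ _ _ (leb6 R) _ (cube p0 (1 / 8) `*` cube q0 (1 / 8))).
- exact: measurable_beam_virial.
- exact: beam_virial_integrand_ge0.
- by apply: measurableX; exact: measurable_cube.
- by apply: leb6_cubes; lra.
- by lra.
case=> [[[a b] c] [[x y] w]] [[[/=]]]; rewrite !in_itv/= => ha hb hc.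
case=> -[/=]; rewrite !in_itv/= => hx hy hw.
rewrite dotC.
have bd (u1 u2 u3 : R) : u1 ^+ 2 <= (5/8) ^+ 2 -> u2 ^+ 2 <= (1/8) ^+ 2 ->
    u3 ^+ 2 <= (1/8) ^+ 2 -> 1 / 4 <= bump 1 (u1, u2, u3).
  move=> h1 h2 h3.
  have h : 1 / 2 <= 1 - dot (u1, u2, u3) (u1, u2, u3) / 1 ^+ 2.
    rewrite expr1n divr1 /dot/= -!expr2; lra.
  rewrite /bump pos_sq_gt0; last by apply: lt_le_trans h; lra.
  by rewrite (_ : 1 / 4 = (1 / 2) ^+ 2); [rewrite ler_pXn2r// nnegrE; lra|field].
have hp : 1 / 4 <= bump 1 (a, b, c) by apply: bd; nra.
have hq : 1 / 4 <= bump 1 (x, y, w) by apply: bd; nra.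
have hd : 1 / 16 <= - dot (a, b, c) (x, y, w).
  by rewrite /dot/=; nra.
have hs : (1 / 16) ^+ 2 <= pos_sq (- dot (a, b, c) (x, y, w)).
  rewrite pos_sq_gt0; last by apply: lt_le_trans hd; lra.
  by rewrite ler_pXn2r// nnegrE; lra.
apply: ler_pM => //.
apply: ler_pM => //.
by apply: ler_pM.
Qed.

(** The mass of core plus beam. It involves neither [s] nor [d], which can therefore be chosen in
    terms of it. *)
Definition mixture_mass : R := 1 + beam_mass.
Local Notation k := mixture_mass.

Lemma mixture_mass_ge1 : 1 <= k. Proof. by rewrite lerDl beam_mass_ge0. Qed.

Lemma mixture_mass_gt0 : 0 < k. Proof. exact: lt_le_trans mixture_mass_ge1. Qed.

Variables (s d : R) (s_gt0 : 0 < s) (s_le1 : s <= 1) (d_gt0 : 0 < d) (d_le1 : d <= 1).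

Definition core (z : phase R) : R := unit_bump d z.1 * unit_bump s z.2.

Lemma core_ge0 z : 0 <= core z.
Proof. by rewrite mulr_ge0// unit_bump_ge0. Qed.

Lemma core_le z : core z <= (bump_mass d)^-1 * (bump_mass s)^-1.
Proof. by rewrite ler_pM ?unit_bump_ge0 ?unit_bump_le. Qed.

Lemma core_eq0 z : (d <= enorm z.1) || (s <= enorm z.2) -> core z = 0.
Proof.
case/orP => h; rewrite /core; first by rewrite (unit_bump_eq0 d_gt0 h) mul0r.
by rewrite (unit_bump_eq0 s_gt0 h) mulr0.
Qed.

Lemma measurable_core : measurable_fun [set: T6] core.
Proof.
by apply: measurable_funM;
  [apply: (measurableT_comp (@measurable_unit_bump R d))|
   apply: (measurableT_comp (@measurable_unit_bump R s))].
Qed.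

Lemma integral_core : (\int[leb6 R]_z (core z)%:E = 1)%E.
Proof.
rewrite [LHS]ge0_integral_leb6_prod ?integral_unit_bump ?mule1//.
- exact: measurable_unit_bump.
- exact: measurable_unit_bump.
- by move=> p; exact: unit_bump_ge0.
- by move=> p; exact: unit_bump_ge0.
Qed.

Definition mixture (z : phase R) : R := (core z + beam z) / k.

Lemma mixture_ge0 z : 0 <= mixture z.
Proof.
apply: divr_ge0; last exact: ltW mixture_mass_gt0.
by rewrite addr_ge0 ?core_ge0 ?beam_ge0.
Qed.

Lemma mixture_ge_core z : core z / k <= mixture z.
Proof. by rewrite ler_pM2r ?invr_gt0 ?mixture_mass_gt0// lerDl beam_ge0. Qed.

Lemma mixture_le z : mixture z <= core z + beam z.
Proof.
rewrite ler_pdivrMr ?mixture_mass_gt0// ler_peMr ?mixture_mass_ge1//.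
by rewrite addr_ge0 ?core_ge0 ?beam_ge0.
Qed.

Lemma mixture_bounded : exists C, forall z, mixture z <= C.
Proof.
exists ((bump_mass d)^-1 * (bump_mass s)^-1 + 1) => z.
apply: (le_trans (mixture_le z)); rewrite lerD ?core_le//.
apply: (le_trans (beam_le_indic z)); rewrite indicE.
by case: (_ \in _).
Qed.

Lemma mixture_eq0 z : (1 <= enorm z.1) || (1 <= enorm z.2) -> mixture z = 0.
Proof.
move=> h; rewrite /mixture beam_eq0// core_eq0 ?addr0 ?mul0r//.
by case/orP : h => h; [rewrite (le_trans d_le1 h)|rewrite (le_trans s_le1 h) orbT].
Qed.

Lemma measurable_mixture : measurable_fun [set: T6] mixture.
Proof.
apply: measurable_funM => //; apply: measurable_funD.
  exact: measurable_core.
exact: measurable_beam.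
Qed.

Lemma integral_mixture : (\int[leb6 R]_z (mixture z)%:E = 1)%E.
Proof.
have mc : measurable_fun [set: T6] (EFin \o core).
  by apply/measurable_EFinP; exact: measurable_core.
have mb : measurable_fun [set: T6] (EFin \o beam).
  by apply/measurable_EFinP; exact: measurable_beam.
transitivity (\int[leb6 R]_z ((core z)%:E + (beam z)%:E) * (k^-1)%:E)%E.
  rewrite -ge0_integralZr//.
  - exact: emeasurable_funD.
  - by move=> z _; rewrite -EFinD lee_fin addr_ge0 ?core_ge0 ?beam_ge0.
  - by rewrite lee_fin invr_ge0 ltW ?mixture_mass_gt0.
rewrite ge0_integralD//; last 2 first.
- by move=> z _; rewrite lee_fin core_ge0.
- by move=> z _; rewrite lee_fin beam_ge0.
by rewrite integral_core integral_beam -EFinD -EFinM mulfV// gt_eqF// mixture_mass_gt0.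
Qed.

End Mixture.

(** * Energy, virial and norm of the mixture *)

Section PotentialOfProducts.
Variable R : realType.
Local Notation T1 := (measurableTypeR R).
Local Notation T3 := (T1 * T1 * T1)%type.
Local Notation T6 := (T3 * T3)%type.
Local Open Scope ereal_scope.

Lemma measurable_div_edist (f : phase R -> R) (q' : space3 R) :
  measurable_fun [set: T6] f ->
  measurable_fun [set: T6] (fun z => f z / edist z.2 q')%R.
Proof.
move=> mf; apply: measurable_funM => //.
apply: measurable_funV; first by move=> z; exact: enorm_ge0.
by apply: measurable_fun_edist.
Qed.

(** The kernel does not involve the momentum, so the integral factors into the mass [G] and the
    potential of [h], to which [potential_bounded] applies. *)
Lemma potential_product (g h : space3 R -> R) (G H C : R) (q' : space3 R) :
  measurable_fun [set: T3] g -> measurable_fun [set: T3] h ->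
  (forall p, 0 <= g p)%R -> (forall q, 0 <= h q <= C)%R ->
  \int[leb3 R]_p (g p)%:E = G%:E -> \int[leb3 R]_q (h q)%:E = H%:E ->
  \int[leb6 R]_z (g z.1 * h z.2 / edist z.2 q')%:E <= (G * (H + 32 * C))%:E.
Proof.
move=> mg mh g0 h0C gG hH.
have h0 q : (0 <= h q)%R by case/andP: (h0C q).
have G0 : (0 <= G)%R.
  by rewrite -lee_fin -gG; apply: integral_ge0 => p _; rewrite lee_fin.
rewrite (_ : \int[_]_z _ =
  \int[leb6 R]_z (g z.1 * (h z.2 / edist z.2 q'))%:E); last first.
  by apply: eq_integral => z _; rewrite mulrA.
rewrite (@ge0_integral_leb6_prod _ g (fun q => h q / edist q q')%R)//.
- rewrite gG EFinM lee_wpmul2l// EFinD -hH.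
  exact: potential_bounded.
- apply: measurable_funM => //.
  apply: measurable_funV; first by move=> z; exact: enorm_ge0.
  by apply: measurable_fun_edist.
- by move=> q; rewrite divr_ge0// enorm_ge0.
Qed.

End PotentialOfProducts.

Section MixtureEstimates.
Variable R : realType.
Local Notation T1 := (measurableTypeR R).
Local Notation T3 := (T1 * T1 * T1)%type.
Local Notation T6 := (T3 * T3)%type.
Local Notation o3 := ((0, 0, 0) : space3 R).
Local Notation k := (mixture_mass R).
Local Notation v := (beam_virial R).
Variables (s d : R) (s_gt0 : 0 < s) (s_le1 : s <= 1) (d_gt0 : 0 < d) (d_le1 : d <= 1).
Local Notation f := (mixture s d).

Let f0 z : 0 <= f z. Proof. exact: mixture_ge0. Qed.
Let mf : measurable_fun [set: T6] f. Proof. exact: measurable_mixture. Qed.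
Let k_gt0 : 0 < k := mixture_mass_gt0 R.

Let div_edist_ge0 (a : R) (q q' : space3 R) : 0 <= a -> 0 <= a / edist q q'.
Proof. by move=> a0; rewrite divr_ge0// enorm_ge0. Qed.

Let ff0 z z' : 0 <= f z * f z'. Proof. exact: mulr_ge0. Qed.

(** The first summand bounds the potential of the core, the second that of the product of two
    unit-radius bumps which dominates the beam. The bound is independent of [d], so [d] can be
    chosen after it. *)
Definition potential_sup : R :=
  1 * (1 + 32 * (bump_mass s)^-1) + bump_mass 1 * (bump_mass 1 + 32 * 1).

Lemma potential_mixture (q' : space3 R) :
  (\int[leb6 R]_z (f z / edist z.2 q')%:E <= potential_sup%:E)%E.
Proof.
pose bb (z : phase R) : R := bump 1 z.1 * bump 1 z.2.
have bb0 z : 0 <= bb z by rewrite mulr_ge0// bump_ge0.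
have mbb : measurable_fun [set: T6] bb.
  by apply: measurable_funM; apply: (measurableT_comp (@measurable_bump R 1)).
have mc := measurable_core s d.
have e0 (z : phase R) : 0 <= (edist z.2 q')^-1 by rewrite invr_ge0 enorm_ge0.
have mce := measurable_div_edist q' mc; have mbe := measurable_div_edist q' mbb.
apply: (@le_trans _ _
    (\int[leb6 R]_z (core s d z / edist z.2 q' + bb z / edist z.2 q')%:E))%E.
  apply: (@ge0_le_integral_real _ _ _ (leb6 R)).
  - exact: measurable_div_edist.
  - exact: measurable_funD.
  - by move=> z; exact: div_edist_ge0.
  - move=> z; rewrite -mulrDl; apply: ler_wpM2r; first exact: e0.
    by apply: (le_trans (mixture_le _ _ _)) => //; rewrite lerD2l beam_le.
have -> : (\int[leb6 R]_z (core s d z / edist z.2 q' + bb z / edist z.2 q')%:E =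
    \int[leb6 R]_z (core s d z / edist z.2 q')%:E +
    \int[leb6 R]_z (bb z / edist z.2 q')%:E)%E.
  apply: (@ge0_integralD _ T6 R (leb6 R) setT measurableT
    (fun z => (core s d z / edist z.2 q')%:E) (fun z => (bb z / edist z.2 q')%:E)).
  - by move=> z _; rewrite lee_fin; apply: div_edist_ge0; exact: core_ge0.
  - exact/measurable_EFinP.
  - by move=> z _; rewrite lee_fin; exact: div_edist_ge0.
  - exact/measurable_EFinP.
rewrite EFinD; apply: leeD.
- apply: potential_product.
  + exact: measurable_unit_bump.
  + exact: measurable_unit_bump.
  + by move=> p; exact: unit_bump_ge0.
  + by move=> q; rewrite unit_bump_ge0 ?unit_bump_le.
  + exact: integral_unit_bump.
  + exact: integral_unit_bump.
- apply: potential_product.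
  + exact: measurable_bump.
  + exact: measurable_bump.
  + by move=> p; exact: bump_ge0.
  + by move=> q; rewrite bump_ge0 bump_le1.
  + exact: integral_bump.
  + exact: integral_bump.
Qed.

(** The uniform bound of the potential is integrated against [f], which has mass 1. *)
Lemma interaction_mixture_le : (interaction f <= potential_sup%:E)%E.
Proof.
have J0 : 0 <= potential_sup.
  rewrite -lee_fin; apply: le_trans (potential_mixture o3).
  by apply: integral_ge0 => z _; rewrite lee_fin div_edist_ge0.
have -> : potential_sup%:E = (\int[leb6 R]_z' (potential_sup * f z')%:E)%E.
  rewrite (@ge0_integralZl_real _ _ _ (leb6 R) potential_sup f mf f0 J0).
  by rewrite (integral_mixture s_gt0 d_gt0) mule1.
apply: ge0_le_integral.
- exact: measurableT.
- move=> z' _; apply: integral_ge0 => z _; rewrite lee_fin.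
  by apply: div_edist_ge0; exact: ff0.
- exact: (measurable_potential mf f0).
- by apply/measurable_EFinP; exact: measurable_funM.
- move=> z' _.
  rewrite (_ : \int[_]_z _ = \int[leb6 R]_z (f z' * (f z / edist z.2 z'.2))%:E)%E.
    rewrite (@ge0_integralZl_real _ _ _ (leb6 R) (f z')
      (fun z => f z / edist z.2 z'.2)).
    + rewrite (mulrC potential_sup) (EFinM (f z')) lee_wpmul2l ?lee_fin ?f0//.
      exact: potential_mixture.
    + exact: measurable_div_edist.
    + by move=> z; apply: div_edist_ge0; exact: f0.
    + exact: f0.
  by apply: eq_integral => z _; rewrite (mulrA (f z') (f z)).
Qed.

(* Two points of the core are at distance at most 2 s. The pointwise bound
   fails at coinciding positions, where the kernel is 0, but these are
   negligible. *)
Lemma interaction_mixture_ge : (((2 * s * k ^+ 2)^-1)%R%:E <= interaction f)%E.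
Proof.
have mc := measurable_core s d.
have c0 z : 0 <= core s d z by exact: core_ge0.
pose A : R := (2 * s * k ^+ 2)^-1.
rewrite -/A; have A0 : 0 <= A by rewrite invr_ge0 !mulr_ge0 ?exprn_ge0// ltW.
(* As the core has mass 1, any constant is an integral against it. Used once for each variable, this
   reduces the claim to a comparison of integrands. *)
have coreZ (c : R) : 0 <= c -> c%:E = (\int[leb6 R]_z (c * core s d z)%:E)%E.
  move=> ?; rewrite (@ge0_integralZl_real _ _ _ (leb6 R) c _ mc c0)//.
  by rewrite (integral_core s_gt0 d_gt0) mule1.
rewrite (coreZ _ A0); apply: ge0_le_integral.
- exact: measurableT.
- by move=> z _; rewrite lee_fin; exact: mulr_ge0.
- by apply/measurable_EFinP; exact: measurable_funM.
- exact: (measurable_potential mf f0).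
move=> z' _.
have Ac0 : 0 <= A * core s d z' by exact: mulr_ge0.
rewrite (coreZ _ Ac0); apply: ae_ge0_le_integral.
- exact: measurableT.
- by move=> z _; rewrite lee_fin; exact: mulr_ge0.
- by apply/measurable_EFinP; exact: measurable_funM.
- by move=> z _; rewrite lee_fin; apply: div_edist_ge0; exact: ff0.
- exact: measurable_interaction_section.
exists [set z | z.2.1.1 = z'.2.1.1]; split.
- exact: measurable_plane.
- exact: leb6_plane.
move=> z /= /not_implyP[_]; apply: contra_notP => zz'.
have e0 : 0 < edist z.2 z'.2 by apply: edist_gt0; exact/eqP.
rewrite lee_fin.
have [h|] := boolP ((d <= enorm z.1) || (s <= enorm z.2)).
  by rewrite (core_eq0 s_gt0 d_gt0 h) mulr0 div_edist_ge0.
have [h' _|] := boolP ((d <= enorm z'.1) || (s <= enorm z'.2)).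
  by rewrite (core_eq0 s_gt0 d_gt0 h') mulr0 mul0r div_edist_ge0.
rewrite !negb_or -!ltNge => /andP[_ h'] /andP[_ h].
have e2 : edist z.2 z'.2 <= 2 * s by apply: (le_trans (edist_le _ _)); lra.
rewrite (_ : A * core s d z' * core s d z =
    (core s d z' / k) * (core s d z / k) / (2 * s)); last first.
  by rewrite /A; move: (core s d z') (core s d z) => c c'; field; rewrite !gt_eqF.
apply: ler_pM.
- by apply: mulr_ge0; apply: divr_ge0 => //; exact: ltW.
- by rewrite invr_ge0 mulr_ge0// ltW.
- apply: ler_pM; try (by apply: divr_ge0 => //; exact: ltW); exact: mixture_ge_core.
- by rewrite lef_pV2// posrE mulr_gt0.
Qed.

(** The weight [sqrt (1 + |p|^2)] is at least 1 everywhere and at most 2 where [f] is nonzero, since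
    [|p| < 1] there; the mass is 1. *)
Lemma kinetic_mixture : (1 <= kinetic f <= 2%:E)%E.
Proof.
have mk : measurable_fun [set: T6]
    (fun z : phase R => Num.sqrt (1 + enorm z.1 ^+ 2) * f z).
  apply: measurable_funM => //; apply: measurable_fun_sqrt.
  apply: measurable_funD => //; apply: measurable_funX.
  exact: measurable_fun_enorm.
apply/andP; split.
  rewrite -(integral_mixture s_gt0 d_gt0).
  apply: (@ge0_le_integral_real _ _ _ (leb6 R) _ _ mf mk f0) => z.
  rewrite ler_peMl// -[leLHS]sqrtr1 ler_sqrt ?addr_ge0 ?sqr_ge0//.
  by rewrite lerDl sqr_ge0.
have -> : (2%:E = \int[leb6 R]_z (2 * f z)%:E)%E.
  rewrite (@ge0_integralZl_real _ _ _ (leb6 R) 2 f mf f0)//.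
  by rewrite (integral_mixture s_gt0 d_gt0) mule1.
apply: (@ge0_le_integral_real _ _ _ (leb6 R) _ _ mk).
- exact: measurable_funM.
- by move=> z; apply: mulr_ge0 => //; exact: sqrtr_ge0.
move=> z.
have [h|h] := leP 1 (enorm z.1); first by rewrite mixture_eq0 ?h// !mulr0.
apply: ler_wpM2r; first exact: f0.
rewrite -[leRHS](ger0_norm (ler0n _ _)) -sqrtr_sqr ler_sqrt ?sqr_ge0//.
have := enorm_ge0 z.1; nra.
Qed.

(** Where [f] is nonzero, [|q.p| <= 1] by Cauchy-Schwarz, so [f] itself is a dominating function. *)
Lemma integrable_virial_mixture :
  (leb6 R).-integrable setT (fun z => (dot z.2 z.1 * f z)%:E).
Proof.
apply: (@le_integrable _ T6 R (leb6 R) setT measurableT _ (EFin \o f)).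
- apply/measurable_EFinP; apply: measurable_funM => //.
  exact: measurable_fun_dot.
- move=> z _ /=; rewrite lee_fin normrM.
  have [h|] := boolP ((1 <= enorm z.1) || (1 <= enorm z.2)).
    by rewrite mixture_eq0// normr0 mulr0.
  rewrite negb_or -!ltNge => /andP[h1 h2].
  apply: ler_piMl => //; apply: (le_trans (normr_dot _ _)).
  by rewrite mulr_ile1 ?enorm_ge0// ltW.
- apply: (@ge0_integrable_real _ _ _ (leb6 R)) => //.
  by rewrite (integral_mixture s_gt0 d_gt0) ltry.
Qed.

(* On the core |q.p| <= s, and the beam contributes - v. *)
Lemma virial_mixture : virial f <= (s - v) / k.
Proof.
have mc := measurable_core s d.
have c0 z : 0 <= core s d z by exact: core_ge0.
have intc : (leb6 R).-integrable setT (EFin \o core s d).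
  apply: (@ge0_integrable_real _ _ _ (leb6 R)) => //.
  by rewrite (integral_core s_gt0 d_gt0) ltry.
have intw : (leb6 R).-integrable setT
    (EFin \o (fun z : phase R => - dot z.2 z.1 * beam z)).
  apply: (@ge0_integrable_real _ _ _ (leb6 R) _ (@measurable_beam_virial R)
    (@beam_virial_integrand_ge0 R)).
  by rewrite (integral_beam_virial R) ltry.
have intcs := @integrableZl _ T6 R (leb6 R) setT measurableT (s / k) _ intc.
have intwk := @integrableZl _ T6 R (leb6 R) setT measurableT k^-1 _ intw.
have E1 : \int[leb6 R]_z (s / k * core s d z) = s / k.
  rewrite (@RintegralZl _ T6)// /Rintegral.
  by rewrite [X in fine X](integral_core s_gt0 d_gt0)/= mulr1.
have E2 : \int[leb6 R]_z (k^-1 * (- dot z.2 z.1 * beam z)) = v / k.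
  rewrite (@RintegralZl _ T6)// /Rintegral.
  by rewrite [X in fine X](integral_beam_virial R)/= mulrC.
have ED := @RintegralD _ T6 R (leb6 R) setT _ _ measurableT
  integrable_virial_mixture intwk.
(* The beam term is moved to the left, where it cancels the beam part of [f] pointwise; only the
   core is left to be estimated. *)
rewrite mulrBl lerBrDr -E1 -E2 /virial -ED.
apply: (@le_Rintegral _ T6) => //.
  exact: (@integrableD _ T6 R (leb6 R) setT measurableT _ _
    integrable_virial_mixture intwk).
move=> z _.
rewrite [leLHS](_ : _ = (dot z.2 z.1 * core s d z) / k); last first.
  by rewrite /mixture; move: (dot _ _) (core _ _ _) (beam _) => x y w;
    field; rewrite gt_eqF.
rewrite [leRHS]mulrAC ler_pM2r ?invr_gt0//.
have [h|] := boolP ((d <= enorm z.1) || (s <= enorm z.2)).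
  by rewrite (core_eq0 s_gt0 d_gt0 h) !mulr0.
rewrite negb_or -!ltNge => /andP[h1 h2].
apply: ler_wpM2r => //; apply: (le_trans (ler_norm _)).
apply: (le_trans (normr_dot _ _)); rewrite -[leRHS]mulr1.
by apply: ler_pM; rewrite ?enorm_ge0// ltW// (lt_le_trans h1).
Qed.

(** After dilation the core has mass [1 / k] and lies in a product of cubes of half-sides [d] and
    [s b], of volume [(2 d)^3 (2 s b)^3 = (4 d s b)^3]. *)
Lemma norm32_mixture (b : R) : 0 < b ->
  k^-1 / (4 * d * s * b) <= norm32 (dilate b f).
Proof.
move=> b0.
have mc := measurable_core s d.
have c0 z : 0 <= core s d z by exact: core_ge0.
have [C fC] := mixture_bounded s_gt0 d_gt0.
have b3 : 0 <= b ^- 3 by rewrite invr_ge0 exprn_ge0// ltW.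
have sb0 : 0 < s * b by rewrite mulr_gt0.
have mck : measurable_fun [set: T6] (fun z => core s d z / k).
  exact: measurable_funM.
apply: (@Lnorm32_ge _ _ (dilate b (fun z => core s d z / k))
  (cube o3 d `*` cube o3 (s * b)) _ _ (b ^- 3 * C)).
- exact: measurable_dilate.
- by move=> z; rewrite dilate_ge0//= ler_wpM2l.
- by rewrite integral_dilate// (integral_mixture s_gt0 d_gt0) ltry.
- exact: measurable_dilate.
- by move=> z; apply: dilate_ge0 => // w; rewrite divr_ge0// ltW.
- move=> z; rewrite indicE; case: (boolP (z \in _)) => [_|].
    by rewrite mulr1 ler_wpM2l// mixture_ge_core.
  move=> zS; rewrite mulr0 /dilate [core _ _ _]core_eq0 ?mul0r ?mulr0//.
  apply: contraNT zS; rewrite negb_or -!ltNge => /andP[h1 h2].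
  have -> : z = scale_pos b (scale_pos b^-1 z).
    by rewrite -{1}[b]invrK scale_posK// invr_gt0.
  rewrite inE; split; apply: enorm_cube => //; try exact: ltW.
  by rewrite enorm_scale3 1?ltW// mulrC ltr_pM2r.
- rewrite integral_dilate//.
  rewrite (_ : \int[_]_z _ = \int[leb6 R]_z (k^-1 * core s d z)%:E)%E.
    rewrite (@ge0_integralZl_real _ _ _ (leb6 R) k^-1 _ mc c0) ?invr_ge0 ?ltW//.
    by rewrite (integral_core s_gt0 d_gt0) mule1.
  by apply: eq_integral => z _; rewrite (mulrC (core s d z)).
- by apply: measurableX; exact: measurable_cube.
- by rewrite !mulr_gt0.
- rewrite leb6_cubes ?ltW//; congr EFin; ring.
Qed.

End MixtureEstimates.

(** * Admissibility of the dilated mixture *)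

Section Admissibility.
Variable R : realType.
Local Notation T1 := (measurableTypeR R).
Local Notation T3 := (T1 * T1 * T1)%type.
Local Notation T6 := (T3 * T3)%type.
Local Notation V3 := (R * R * R)%type.
Local Notation V := (V3 * V3)%type.

Lemma cont_diff_dot (x y z x' y' z' : V -> R) :
  cont_diff x -> cont_diff y -> cont_diff z ->
  cont_diff x' -> cont_diff y' -> cont_diff z' ->
  cont_diff (fun w => dot (x w, y w, z w) (x' w, y' w, z' w)).
Proof.
move=> *; rewrite /dot/=.
by apply: cont_diffD; [apply: cont_diffD|]; exact: cont_diffM.
Qed.

Lemma cont_diff_bump (r : R) (x y z : V -> R) :
  cont_diff x -> cont_diff y -> cont_diff z ->
  cont_diff (fun w => bump r (x w, y w, z w)).
Proof.
move=> cx cy cz; apply: cont_diff_pos_sq.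
rewrite (_ : (fun _ => _) =
    fun w => 1 + (- (r ^+ 2)^-1) * dot (x w, y w, z w) (x w, y w, z w)).
  apply: cont_diffD; first exact: cont_diff_cst.
  by apply: cont_diffM; [exact: cont_diff_cst|exact: cont_diff_dot].
by apply/funext => w; rewrite mulNr mulrC.
Qed.

Variables (b s d : R) (b_gt0 : 0 < b).
Variables (s_gt0 : 0 < s) (s_le1 : s <= 1) (d_gt0 : 0 < d) (d_le1 : d <= 1).
Local Notation f := (mixture s d).

Lemma is_C1_dilate_mixture : is_C1 (dilate b f).
Proof.
have [x1 x2 x3 y1 [y2 y3]] := cont_diff_coords R.
have cst (c : R) := cont_diff_cst V c.
have z1 := cont_diffM (cst b^-1) y1.
have z2 := cont_diffM (cst b^-1) y2.
have z3 := cont_diffM (cst b^-1) y3.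
have B1 r := @cont_diff_bump r _ _ _ x1 x2 x3.
have B2 r := @cont_diff_bump r _ _ _ z1 z2 z3.
have Dm := cont_diff_dot x1 x2 x3 z1 z2 z3.
rewrite -/(cont_diff (dilate b f : V -> R)).
(* The density is spelled out in coordinates, with quotients and the sign as products by constants,
   to match the closure properties of [cont_diff]. *)
rewrite (_ : dilate b f = fun z : V => b ^- 3 * (((
  (bump d (z.1.1.1, z.1.1.2, z.1.2) * (bump_mass d)^-1) *
  (bump s (b^-1 * z.2.1.1, b^-1 * z.2.1.2, b^-1 * z.2.2) * (bump_mass s)^-1)) +
  (bump 1 (z.1.1.1, z.1.1.2, z.1.2) *
    bump 1 (b^-1 * z.2.1.1, b^-1 * z.2.1.2, b^-1 * z.2.2)) *
  pos_sq (- 1 * dot (z.1.1.1, z.1.1.2, z.1.2)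
    (b^-1 * z.2.1.1, b^-1 * z.2.1.2, b^-1 * z.2.2))) * (mixture_mass R)^-1)).
  exact: (cont_diffM (cst _) (cont_diffM (cont_diffD
    (cont_diffM (cont_diffM (B1 d) (cst _)) (cont_diffM (B2 s) (cst _)))
    (cont_diffM (cont_diffM (B1 1) (B2 1))
      (cont_diff_pos_sq (cont_diffM (cst (- 1)) Dm)))) (cst _))).
by apply/funext => -[[[? ?] ?] [[? ?] ?]]; rewrite mulN1r.
Qed.

(** The mixture is a function of [p.p], [q.q] and [p.q], and dilation commutes with rotations. *)
Lemma spherically_symmetric_dilate_mixture : spherically_symmetric (dilate b f).
Proof.
move=> O rO p q; rewrite /dilate /mixture /core /beam /unit_bump /bump /=.
by rewrite mxact_scale3 !dot_mxact.
Qed.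

(** Where the density is nonzero, [|p| < 1] and [|q| < b]; hence the moment of order [n] is at most
    [(1 + b)^n]. *)
Lemma P3C1_dilate_mixture : P3C1 (dilate b f).
Proof.
have mf := measurable_mixture s d.
have f0 z : 0 <= f z by exact: mixture_ge0.
have g0 z : 0 <= dilate b f z by exact: dilate_ge0.
have mg : measurable_fun [set: T6] (dilate b f) by exact: measurable_dilate.
have intg : (\int[leb6 R]_z (dilate b f z)%:E = 1)%E.
  by rewrite integral_dilate// integral_mixture.
have e0 (z : phase R) : 0 <= enorm z.1 + enorm z.2 by rewrite addr_ge0 ?enorm_ge0.
split => //; first exact: is_C1_dilate_mixture.
move=> n _.
apply: (@le_lt_trans _ _ (\int[leb6 R]_z (((1 + b) ^+ n)%:E * (dilate b f z)%:E)))%E.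
  apply: ge0_le_integral => //.
  - by move=> z _; rewrite lee_fin mulr_ge0// exprn_ge0.
  - apply/measurable_EFinP; apply: measurable_funM => //.
    apply: measurable_funX; apply: measurable_funD; exact: measurable_fun_enorm.
  - by apply: emeasurable_funM => //; exact/measurable_EFinP.
  - move=> z _; rewrite -EFinM lee_fin.
    have [h|] := boolP ((1 <= enorm z.1) || (1 <= enorm (scale3 b^-1 z.2))).
      by rewrite /dilate (mixture_eq0 s_gt0 s_le1 d_gt0 d_le1) ?mulr0//.
    rewrite negb_or -!ltNge enorm_scale3 ?invr_ge0 ?(ltW b_gt0)// => /andP[h1 h2].
    apply: ler_wpM2r => //; apply: lerXn2r;
      rewrite ?nnegrE ?addr_ge0 ?enorm_ge0 ?(ltW b_gt0)//.
    apply: lerD; first exact: ltW.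
    by move: h2; rewrite mulrC ltr_pdivrMr// mul1r => /ltW.
rewrite (@ge0_integralZl_EFin _ T6 R (leb6 R) setT measurableT (EFin \o dilate b f)).
- by rewrite [X in (_ * X)%E]intg mule1 ltry.
- by move=> z _; rewrite lee_fin.
- exact/measurable_EFinP.
- by rewrite exprn_ge0// addr_ge0// ltW.
Qed.

End Admissibility.

(** * Choice of the parameters and conclusion *)

Unset Implicit Arguments.

Theorem mainTheorem2 (R : realType) (M : R) (hM : 0 < M) :
  exists f0 : phase R -> R,
    [/\ P3C1 f0, spherically_symmetric f0,
        energy f0 = 0%E,
        virial f0 < - M &
        norm32 f0 > 3 / 8 * (15 / 16) `^ (1 / 3)].
Proof.
set v := beam_virial R; set k := mixture_mass R.
have v0 : 0 < v := beam_virial_gt0 R.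
have k1 : 1 <= k := mixture_mass_ge1 R.
have k0 : 0 < k := mixture_mass_gt0 R.
have k30 : 0 < k ^+ 3 by rewrite exprn_gt0.
(* The first bound keeps the core in the unit ball, the second gives [virial f <= - v / (2 k)]. With
   [b >= 1 / (8 s k^2)], proved below, the third gives [b v / (2 k) >= 2 M]. *)
pose s := Num.min 1 (Num.min (v / 2) (v / (32 * M * k ^+ 3))).
have s0 : 0 < s.
  by rewrite !lt_min ltr01 !divr_gt0// !mulr_gt0.
have s1 : s <= 1 by rewrite ge_min lexx.
have sv : s <= v / 2 by rewrite !ge_min lexx orbT.
have sM : s * (32 * M * k ^+ 3) <= v.
  by rewrite -ler_pdivlMr ?mulr_gt0// !ge_min lexx !orbT.
set J := potential_sup s.
have J0 : 0 < J.
  by rewrite /J /potential_sup addr_gt0// ?mulr_gt0 ?addr_gt0 ?mulr_gt0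
    ?invr_gt0 ?bump_mass_gt0.
(* Together with [b <= J / 2] this gives [4 d s b <= 1 / k], so that [norm32_mixture] yields a norm
   of at least 1. *)
pose d := Num.min 1 (2 * s * J * k)^-1.
have d0 : 0 < d by rewrite lt_min ltr01 invr_gt0 !mulr_gt0.
have d1 : d <= 1 by rewrite ge_min lexx.
have dJ : d * (2 * s * J * k) <= 1.
  by rewrite -ler_pdivlMr ?mulr_gt0// mul1r ge_min lexx orbT.
have mf := measurable_mixture s d.
pose f := mixture s d.
have f0 z : 0 <= f z by exact: mixture_ge0.
have [K1 K2] := andP (kinetic_mixture s0 s1 d0 d1).
have I1 := interaction_mixture_ge s0 d0.
have I2 := interaction_mixture_le s0 d0.
have Kfin : kinetic f = (fine (kinetic f))%:E.
  by rewrite fineK// fin_numE; apply/andP; split; apply/eqP => h;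
    [move: K1; rewrite h|move: K2; rewrite h].
have Ifin : interaction f = (fine (interaction f))%:E.
  by rewrite fineK// fin_numE; apply/andP; split; apply/eqP => h;
    [move: I1; rewrite h|move: I2; rewrite h].
move: K1 K2 I1 I2; rewrite -/f Kfin Ifin !lee_fin -/J -/k.
set K := fine _; set I := fine _ => K1 K2 I1 I2.
have K0 : 0 < K by lra.
have I0 : 0 < I.
  by apply: lt_le_trans I1; rewrite invr_gt0 !mulr_gt0// exprn_gt0.
pose b := I / (2 * K).
have b0 : 0 < b by rewrite divr_gt0// mulr_gt0.
(* From [1 <= K] and [I <= J]. *)
have bJ : b <= J / 2.
  rewrite /b ler_pdivrMr ?mulr_gt0//; nra.
(* From [K <= 2], hence [b >= I / 4], and [I >= 1 / (2 s k^2)]. *)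
have bs : 1 <= b * (8 * s * k ^+ 2).
  have h : 1 <= I * (2 * s * k ^+ 2).
    by rewrite -ler_pdivrMr ?mul1r// !mulr_gt0// exprn_gt0.
  apply: (le_trans h); rewrite /b -(@ler_pM2r _ (2 * K)) ?mulr_gt0//.
  rewrite [leRHS](_ : _ = I * (2 * s * k ^+ 2) * 4); last by field; rewrite gt_eqF.
  by rewrite ler_pM2l ?(lt_le_trans _ h)//; lra.
exists (dilate b f); split.
- exact: P3C1_dilate_mixture.
- exact: spherically_symmetric_dilate_mixture.
- rewrite /energy kinetic_dilate// interaction_dilate// Kfin Ifin -/K -/I.
  rewrite -!EFinM -EFinB; congr EFin; rewrite /b; field.
  by rewrite !gt_eqF.
- rewrite virial_dilate//; last exact: integrable_virial_mixture.
  have hv := virial_mixture s0 s1 d0 d1.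
  have {}hv : virial f <= - (v / (2 * k)).
    apply: (le_trans hv); rewrite -/v -/k ler_pdivrMr//.
    rewrite [leRHS](_ : _ = - (v / 2)); first by lra.
    by field; rewrite gt_eqF.
  have {hv} : b * virial f <= - (b * (v / (2 * k))) by rewrite -mulrN ler_pM2l.
  move=> /le_lt_trans; apply; rewrite ltrN2.
  have -> : b * (v / (2 * k)) = b * v / (2 * k) by rewrite mulrA.
  rewrite ltr_pdivlMr ?mulr_gt0//.
  apply: (@lt_le_trans _ _ (b * (s * (32 * M * k ^+ 3)))); last by rewrite ler_pM2l.
  rewrite [ltRHS](_ : _ = (M * (2 * k)) * (2 * (b * (8 * s * k ^+ 2)))); last by ring.
  by rewrite ltr_pMr ?mulr_gt0//; lra.
- apply: lt_le_trans (norm32_mixture s0 d0 b0).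
  (* The required bound is at most 3/8, so a norm of at least 1 is more than enough. *)
  apply: (@lt_le_trans _ _ 1).
    have : (15 / 16 : R) `^ (1 / 3) <= 1 `^ (1 / 3).
      by rewrite ge0_ler_powR// ?nnegrE; lra.
    by rewrite powR1; lra.
  have ds0 : 0 < 4 * d * s by rewrite !mulr_gt0.
  have dsb0 : 0 < 4 * d * s * b by rewrite mulr_gt0.
  rewrite -/k ler_pdivlMr// mul1r -[leRHS]mul1r ler_pdivlMr//.
  apply: le_trans dJ.
  rewrite [leLHS](_ : _ = (4 * d * s * k) * b); last by ring.
  rewrite [leRHS](_ : _ = (4 * d * s * k) * (J / 2)); last by field.
  by rewrite ler_pM2l// mulr_gt0.
Qed.
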